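(* Consider the problem $\min_{x\in X}\psi_0(x)$ s.t. $\psi_i(x)\le 0$, $i=1,\dots,m$, and the Aug-ConEx method, both described in the context, in the convex case $\mu_f=0$. Let $B\ge 1$ be a constant, $\rho_1>0$, $K\ge 2$, and let $(x^*,y^* )$ be a saddle point of the Lagrangian. Put $$\mathcal H_*:=L_gD_X\big[\|y^*\|+1-B\big]_+ + H_g(\|y^*\|+1),\qquad M:=M_g+M_\chi,\qquad S:=\sqrt{120K\big(\mathcal H_*^2+2(H_f^2+\sigma^2)\big)}.$$ Suppose Aug-ConEx is run for $k=1,\dots,K-1$ with $$\tau_k=\tfrac{2}{k+1},\quad \rho_{k+1}=\rho_1(k+2),\quad \eta_k=\rho_1\tfrac{k^2}{K},\quad \beta_{k+1}=\tfrac{(1-\tau_k)\tau_{k+1}}{\tau_k},$$ $$L_k=L=2\big(L_f+BL_g+\rho_1KM^2\big)+\tfrac{K S}{120D_X}.$$ Then $$\mathbb E[\psi_0(x_K)-\psi_0(x^* )]\le \tfrac{13D_XS}{60(K-1)}+\tfrac{\|y_1\|^2}{(K-1)\rho_1}+\tfrac{52D_X^2(L_f+BL_g+\rho_1KM^2)}{(K-1)K}+\tfrac{80D_X(K+3)(H_f^2+\sigma^2)}{K(240D_X\rho_1M^2+S)}+\tfrac{2(H_f^2+\sigma^2)}{K^2(K-1)\rho_1M^2}$$ and $$\mathbb E\big[\|[\psi(x_K)]_+\|\big]\le \tfrac{13D_XS}{6(K-1)}+\tfrac{52D_X^2(L_f+BL_g+\rho_1KM^2)}{(K-1)K}+\tfrac{40D_X(K+3)(\mathcal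 H_*^2+2(H_f^2+\sigma^2))}{K(240D_X\rho_1M^2+S)}+\tfrac{\mathbb E[\|y_1-\hat y\|^2]}{(K-1)\rho_1}+\tfrac{\mathcal H_*^2+2(H_f^2+\sigma^2)}{K^2(K-1)\rho_1M^2},$$ where $\hat y=(\|y^*\|+1)\dfrac{[\psi(x_K)]_+}{\|[\psi(x_K)]_+\|}$ (with $\hat y:=0$ if $[\psi(x_K)]_+=0$).
   Context: **Problem.** $X\subset\mathbb R^n$ is convex and compact, $D_X:=\max_{x,y\in X}\|x-y\|/2>0$ (Euclidean norms throughout). $\psi_0=f+\chi_0$, $\psi_i=g_i+\chi_i$ for $i=1,\dots,m$; $f,g_i:X\to\mathbb R$ are convex, $\chi_0$ is convex, proper, lower semicontinuous, $\chi_1,\dots,\chi_m$ are continuous and convex. Write $\psi=(\psi_1,\dots,\psi_m)^\top$, $g=(g_1,\dots,g_m)^\top$, $\chi=(\chi_1,\dots,\chi_m)^\top$, and $g'(x)=[g_1'(x),\dots,g_m'(x)]\in\mathbb R^{n\times m}$ with $g_i'(x)\in\partial g_i(x)$. $[\cdot]_+$ is the elementwise positive part. $f$ is $\mu_f$-strongly convex, $\mu_f\ge0$: $f(x)\ge f(y)+\langle f'(y),x-y\rangle+\frac{\mu_f}{2}\|x-y\|^2$ for $x,y\in X$; $\mu_f=0$ means merely convex. **Assumptions.** For all $x,y\in X$, all $f'(y)\in\partial f(y)$, $g_i'(y)\in\partial g_i(y)$, $i=1,\dots,m$ (all constants nonnegative): - $f(x)-f(y)-\langle f'(y),x-y\rangle\le\frac{L_f}{2}\|x-y\|^2+H_f\|x-y\|$;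 - $g_i(x)-g_i(y)-\langle g_i'(y),x-y\rangle\le\frac{L_{g_i}}{2}\|x-y\|^2+H_{g_i}\|x-y\|$; - $g_i(x)-g_i(y)\le M_{g_i}\|x-y\|$ and $\chi_i(x)-\chi_i(y)\le M_{\chi_i}\|x-y\|$. Set $L_g=(\sum_iL_{g_i}^2)^{1/2}$, $H_g=(\sum_iH_{g_i}^2)^{1/2}$, $M_g=(\sum_iM_{g_i}^2)^{1/2}$, $M_\chi=(\sum_iM_{\chi_i}^2)^{1/2}$, with $M_g+M_\chi>0$. Here $\partial h(x)$, for $x$ in the relative interior of $X$, consists of the subgradients lying in the linear span of $X-X$, and at other points of $X$ of limits of such subgradients along sequences of relative interior points converging to $x$; in particular $\|g_i'(x)\|\le M_{g_i}$. **Stochastic oracle.** For $x\in X$, $\mathfrak F(x,\xi)$ satisfies $\mathbb E[\mathfrak F(x,\xi)]=f'(x)\in\partial f(x)$ and $\mathbb E\|\mathfrak F(x,\xi)-f'(x)\|^2\le\sigma^2$. The samples $\xi_1,\xi_2,\dots$ are independent, and $\xi_k$ is independent of the query point $\hat x_k$ and all quantities generated before iteration $k$. **Saddle point.** With $\mathcal L(x,y)=\psi_0(x)+\langle y,\psi(x)\rangle$, it is assumed that there is $(x^*,y^* )\in X\times\mathbb R^m_+$ with $\mathcal L(x^*,y)\le\mathcal L(x^*,y^* )\le\mathcal L(x,y^* )$ for all $(x,y)\in X\times\mathbb R^m_+$, and $\mathcal L(x^*,y^* )$ finite. Then $x^*$ is an optimal solution. **Aug-ConEx method.** Input $x_1\in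 X$, $y_1\in\mathbb R^m$ (deterministic), and parameters $\rho_k,\eta_k,L_k>0$, $\tau_k\in(0,1]$, $\beta_{k+1}$. Set $\hat x_1=x_1$, $\tilde y_1=y_1$, $s_1=0$, $V_1=g(x_1)+\chi(x_1)$. For $k=1,\dots,K-1$, with $\ell_g(x):=g(\hat x_k)+g'(\hat x_k)^\top(x-\hat x_k)$, find $(s_{k+1},x_{k+1})$ satisfying simultaneously $$s_{k+1}=\arg\min_{s\le 0}\ \langle-\tilde y_k,s\rangle+\tfrac{\rho_k}{2}\|\ell_g(x_{k+1})+\chi(x_{k+1})-(1-\tau_k)V_k-s\|^2,$$ $$x_{k+1}=\arg\min_{x\in X}\ \chi_0(x)+\langle y_{k+1},\chi(x)\rangle+\langle\mathfrak F(\hat x_k,\xi_k)+g'(\hat x_k)y_{k+1},x\rangle+\tfrac{L_k}{2}\|x-\hat x_k\|^2,$$ where $\tilde V_{k+1}=\ell_g(x_{k+1})+\chi(x_{k+1})-s_{k+1}$ and $y_{k+1}=\tilde y_k+\rho_k(\tilde V_{k+1}-(1-\tau_k)V_k)$. Then set $V_{k+1}=g(x_{k+1})+\chi(x_{k+1})-s_{k+1}$, $\tilde y_{k+1}=\tilde y_k+\eta_k(\tilde V_{k+1}-(1-\tau_k)V_k)$, $\hat x_{k+1}=x_{k+1}+\beta_{k+1}(x_{k+1}-x_k)$. Output $x_K$. The first-order information of $f,g_i$ is evaluated at $\hat x_k$, so the points $\hat x_k$ are understood to lie in $X$. *)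

(* Defs.v *)
(* MathComp / MathComp-Analysis. *)
From HB Require Import structures.
From mathcomp Require Import all_boot all_order all_algebra.
From mathcomp Require Import all_classical all_reals all_analysis.

Set Implicit Arguments.
Unset Strict Implicit.
Unset Printing Implicit Defensive.

Import Order.TTheory GRing.Theory Num.Theory.
Import numFieldNormedType.Exports.

Local Open Scope classical_set_scope.
Local Open Scope ring_scope.

Section Euclidean.
Context {R : realType}.

Definition dot n (u v : 'cV[R]_n) : R := \sum_i u i 0 * v i 0.

(* The norm that the library puts on matrices is the sup norm; its topology is
   the Euclidean one. *)
Definition enorm n (u : 'cV[R]_n) : R := Num.sqrt (\sum_i u i 0 ^+ 2).

(* Under compactness of X the supremum is a maximum. *)
Definition half_diam n (X : set 'cV[R]_n) : R :=
  sup [set enorm (p.1 - p.2) | p in X `*` X] / 2.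

Definition pos_part m (u : 'cV[R]_m) : 'cV[R]_m :=
  map_mx (fun t => Num.max t 0) u.

Definition nonneg_orthant m : set 'cV[R]_m :=
  [set y | forall i, 0 <= y i 0].

End Euclidean.

Section ConvexAnalysis.
Context {R : realType} {n : nat}.
Implicit Types (X : set 'cV[R]_n) (h : 'cV[R]_n -> R) (x v : 'cV[R]_n).

(* Convexity of an extended-valued function that does not take the value -oo
   on X; the convention 0 * +oo = 0 makes t = 0 and t = 1 harmless. *)
Definition econvex_on X (h : 'cV[R]_n -> \bar R) : Prop :=
  forall x y (t : R), X x -> X y -> 0 <= t <= 1 ->
    (h (t *: x + (1 - t) *: y)%R
       <= t%:E * h x + (1 - t)%:E * h y)%E.

Definition proper_on X (h : 'cV[R]_n -> \bar R) : Prop :=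
  (forall x, X x -> h x != -oo%E) /\ (exists2 x, X x & h x != +oo%E).

(* The linear span of X - X, that is, the direction of the affine hull of X. *)
Definition dir_span X : set 'cV[R]_n :=
  [set v | exists2 w : seq 'cV[R]_n,
    forall u, u \in w -> exists x y, [/\ X x, X y & u = x - y]
    & v \in <<w>>%VS].

Definition rel_interior X : set 'cV[R]_n :=
  [set x | X x /\ exists2 e : R, 0 < e &
    forall v, dir_span X v -> enorm v < e -> X (x + v)].

Definition subgradient X h x : set 'cV[R]_n :=
  [set v | forall z, X z -> h x + dot v (z - x) <= h z].

Definition subdiff X h x : set 'cV[R]_n :=
  [set v |
     [/\ rel_interior X x, subgradient X h x v & dir_span X v]
  \/ [/\ X x, ~ rel_interior X x &
      exists u w : nat -> 'cV[R]_n,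
        [/\ forall j, [/\ rel_interior X (u j),
                          subgradient X h (u j) (w j) & dir_span X (w j)],
            u @ \oo --> x & w @ \oo --> v]]].

(* The inequality h(z) - h(x) - <h'(x), z - x> <= L/2 |z - x|^2 + H |z - x|,
   required for every subgradient h'(x) of the subdifferential above. *)
Definition upper_model X h (L H : R) : Prop :=
  forall z x v, X z -> X x -> subdiff X h x v ->
    h z - h x - dot v (z - x)
      <= L / 2 * enorm (z - x) ^+ 2 + H * enorm (z - x).

Definition lipschitz_bound X h (M : R) : Prop :=
  forall z x, X z -> X x -> h z - h x <= M * enorm (z - x).

End ConvexAnalysis.

Section Optimization.
Context {R : realType} {n m : nat}.
Variables (X : set 'cV[R]_n) (f : 'cV[R]_n -> R) (chi0 : 'cV[R]_n -> \bar R)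
  (g chi : 'cV[R]_n -> 'cV[R]_m).

Definition psi0 (x : 'cV[R]_n) : \bar R := ((f x)%:E + chi0 x)%E.

Definition psi (x : 'cV[R]_n) : 'cV[R]_m := g x + chi x.

Definition lagrangian (x : 'cV[R]_n) (y : 'cV[R]_m) : \bar R :=
  (psi0 x + (dot y (psi x))%:E)%E.

Definition saddle_point (xs : 'cV[R]_n) (ys : 'cV[R]_m) : Prop :=
  [/\ X xs, nonneg_orthant ys, lagrangian xs ys \is a fin_num &
      forall x y, X x -> nonneg_orthant y ->
        (lagrangian xs y <= lagrangian xs ys)%E /\
        (lagrangian xs ys <= lagrangian x ys)%E].

End Optimization.

Definition is_argmin d (O : porderType d) T (D : set T) (phi : T -> O) (z : T)
  : Prop := D z /\ forall t, D t -> (phi z <= phi t)%O.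

(* The quantities x_k, \hat x_k, s_k, y_k, \tilde y_k, V_k. *)
Record state (R : realType) (n m : nat) := State {
  st_x : 'cV[R]_n;
  st_xhat : 'cV[R]_n;
  st_s : 'cV[R]_m;
  st_y : 'cV[R]_m;
  st_ytilde : 'cV[R]_m;
  st_V : 'cV[R]_m }.

Section AugConEx.
Context {R : realType} {n m : nat}.
Variables (X : set 'cV[R]_n) (chi0 : 'cV[R]_n -> \bar R)
  (g chi : 'cV[R]_n -> 'cV[R]_m) (g' : 'cV[R]_n -> 'M[R]_(n, m)).

Definition linearization (xhat x : 'cV[R]_n) : 'cV[R]_m :=
  g xhat + (g' xhat)^T *m (x - xhat).

Definition init_state (x1 : 'cV[R]_n) (y1 : 'cV[R]_m) : state R n m :=
  State x1 x1 0 y1 y1 (g x1 + chi x1).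

(* One iteration, from the state at k to the state at k+1, with parameters
   rho_k, eta_k, L_k, tau_k, beta_{k+1}; G is the stochastic gradient
   F(\hat x_k, xi_k).  The two argmin conditions are coupled: the first one
   involves x_{k+1}, and the second one involves s_{k+1} through y_{k+1}. *)
Definition aug_conex_step (rho eta L tau beta : R) (G : 'cV[R]_n)
    (a b : state R n m) : Prop :=
  let xhat := st_xhat a in
  let W := (1 - tau) *: st_V a in
  let Vtilde := linearization xhat (st_x b) + chi (st_x b) - st_s b in
  is_argmin [set s : 'cV[R]_m | forall i, s i 0 <= 0]
      (fun s => dot (- st_ytilde a) s + rho / 2 *
         enorm (linearization xhat (st_x b) + chi (st_x b) - W - s) ^+ 2)
      (st_s b)
  /\ is_argmin X
      (fun z => (chi0 z + (dot (st_y b) (chi z)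
                          + dot (G + g' xhat *m st_y b) z
                          + L / 2 * enorm (z - xhat) ^+ 2)%:E)%E)
      (st_x b)
  /\ st_y b = st_ytilde a + rho *: (Vtilde - W)
  /\ st_V b = g (st_x b) + chi (st_x b) - st_s b
  /\ st_ytilde b = st_ytilde a + eta *: (Vtilde - W)
  /\ st_xhat b = st_x b + beta *: (st_x b - st_x a).

End AugConEx.

Section Probability.
Local Open Scope ereal_scope.

Definition borel_cV (R : realType) (n : nat) : measurableType _ :=
  g_sigma_algebraType (@open 'cV[R]_n).

Context {R : realType} {n m : nat} {d d' : measure_display}
  {Omega : measurableType d} {Xi : measurableType d'}.
Variable (P : probability Omega R).

Definition random_vector p (U : Omega -> 'cV[R]_p) : Prop :=
  measurable_fun [set: Omega] (U : Omega -> borel_cV R p).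

Definition random_state (Z : Omega -> state R n m) : Prop :=
  random_vector (fun w => st_x (Z w)) /\
  random_vector (fun w => st_xhat (Z w)) /\
  random_vector (fun w => st_s (Z w)) /\
  random_vector (fun w => st_y (Z w)) /\
  random_vector (fun w => st_ytilde (Z w)) /\
  random_vector (fun w => st_V (Z w)).

Definition vector_events p (U : Omega -> 'cV[R]_p) : set_system Omega :=
  preimage_set_system [set: Omega] (U : Omega -> borel_cV R p) measurable.

Definition state_events (Z : Omega -> state R n m) : set_system Omega :=
  vector_events (fun w => st_x (Z w)) `|`
  vector_events (fun w => st_xhat (Z w)) `|`
  vector_events (fun w => st_s (Z w)) `|`
  vector_events (fun w => st_y (Z w)) `|`
  vector_events (fun w => st_ytilde (Z w)) `|`
  vector_events (fun w => st_V (Z w)).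

(* The sigma-algebra generated by everything produced before iteration k:
   the states 1, ..., k (in particular \hat x_k) and the samples 1, ..., k-1. *)
Definition history (Z : nat -> Omega -> state R n m) (xi : nat -> Omega -> Xi)
    (k : nat) : set_system Omega :=
  <<s (\bigcup_(j in [set j | (0 < j <= k)%N]) state_events (Z j)) `|`
      (\bigcup_(j in [set j | (0 < j < k)%N])
         preimage_set_system [set: Omega] (xi j) measurable) >>.

Definition independent_of (E : set_system Omega) (U : Omega -> Xi) : Prop :=
  forall A C, E A -> measurable C ->
    P (A `&` U @^-1` C) = P A * P (U @^-1` C).

Definition mutually_independent (I : set nat) (xi : nat -> Omega -> Xi)
  : Prop :=
  forall (J : seq nat) (C : nat -> set Xi), uniq J ->
    (forall j, j \in J -> I j) -> (forall j, measurable (C j)) ->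
    P (\bigcap_(j in [set` J]) (xi j @^-1` C j))
      = \prod_(j <- J) P (xi j @^-1` C j).

(* F is jointly measurable on X x Xi, and for a sample U, at each x in X:
   E[F(x, U)] = f'(x) coordinatewise (a finite value of the integral entails
   integrability) and E|F(x, U) - f'(x)|^2 <= sigma^2. *)
Definition measurable_oracle (X : set 'cV[R]_n)
    (F : 'cV[R]_n -> Xi -> 'cV[R]_n) : Prop :=
  measurable_fun ((X : set (borel_cV R n)) `*` [set: Xi])
    (fun p : borel_cV R n * Xi => F p.1 p.2 : borel_cV R n).

Definition unbiased_bounded_variance (X : set 'cV[R]_n)
    (F : 'cV[R]_n -> Xi -> 'cV[R]_n) (f' : 'cV[R]_n -> 'cV[R]_n) (sigma : R)
    (U : Omega -> Xi) : Prop :=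
  forall x, X x ->
    (forall i, 'E_P[(fun w => F x (U w) i 0%R)] = (f' x i 0%R)%:E) /\
    'E_P[(fun w => enorm (F x (U w) - f' x)%R ^+ 2)%R] <= (sigma ^+ 2)%:E.

End Probability.

(* Main.v *)
Require Import Defs.
From HB Require Import structures.
From mathcomp Require Import all_boot all_order all_algebra.
From mathcomp Require Import all_classical all_reals all_analysis.
From mathcomp Require Import measurable_realfun lebesgue_integral_fubini ring lra.

(** Write x_{k+1} = (1 - tau_k) x_k + tau_k z_{k+1}, so that also
    hat x_k = (1 - tau_k) x_k + tau_k z_k.  Comparing x_{k+1} with
    (1 - tau_k) x_k + tau_k xs in the proximal subproblem, and expanding the
    dual update, gives for every y >= 0 a recursion for the gap
    Q_k(y) = psi0(x_k) - psi0(xs) + <y, V_k>.  Multiplied by k (k + 1) it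
    telescopes, except that the weights 2 L k / (k + 1) of |z_k - xs|^2
    increase while the points z_k need not lie in X.  Half of the curvature
    term L |x_{k+1} - hat x_k|^2 pays for this: the x_k are averages of the
    z_j and stay in X, and the potential
    |u|^2 - (2 / k) <u, v> + |v|^2 / k, with u = z_k - xs and v = x_k - xs,
    turns boundedness of v into a total contribution of at most 26 L D^2.
    The other half absorbs the nonsmoothness and the noise, whose inner
    product with the predictable direction has mean zero by independence.
    Finally y = 0 yields the objective bound, and y = yhat the feasibility
    bound. *)

Set Implicit Arguments.
Unset Strict Implicit.
Unset Printing Implicit Defensive.

Import Order.TTheory GRing.Theory Num.Theory.
Import numFieldNormedType.Exports.

Local Open Scope classical_set_scope.
Local Open Scope ring_scope.

(** * Euclidean geometry *)

(** The dual iterates are never bounded. The linearization error of the constraints is paired with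
    the free multiplier y, not with y_{k+1}, and the weights k (k + 1) / (2 eta_k) of |ytilde_k -
    y|^2 decrease in k because eta_k grows like k^2; only the first dual distance survives.

    The estimate holds on each sample path and for all y >= 0. This is essential, since yhat depends
    on the path: y enters the upper bound only through |y_1 - y|^2 and a constant, while the
    zero-mean noise terms are free of y.

    The curvature L covers the quadratic error of g only for multipliers of norm at most B. Beyond B
    that error is made linear with |x_{k+1} - hat x_k| <= 2 D, which is the origin of the term L_g D
    [|y| - B]_+.

    Two degeneracies need care. The value chi_0(x_1) may be infinite; it is harmless because tau_1 =
    1 gives it coefficient 0. And psi_0(x_K) need not be a measurable function of the sample, so its
    integral is compared with that of an integrable majorant. *)

Section EuclideanSpace.
Context {R : realType} {n : nat}.
Implicit Types (u v w x y z : 'cV[R]_n) (X : set 'cV[R]_n).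

Lemma dotC u v : dot u v = dot v u.
Proof. by apply: eq_bigr => i _; rewrite mulrC. Qed.

Lemma dotDl u v w : dot (u + v) w = dot u w + dot v w.
Proof. by rewrite -big_split; apply: eq_bigr => i _; rewrite mxE mulrDl. Qed.

Lemma dotDr u v w : dot w (u + v) = dot w u + dot w v.
Proof. by rewrite !(dotC w) dotDl. Qed.

Lemma dotZl a u w : dot (a *: u) w = a * dot u w.
Proof. by rewrite mulr_sumr; apply: eq_bigr => i _; rewrite mxE mulrA. Qed.

Lemma dotZr a u w : dot w (a *: u) = a * dot w u.
Proof. by rewrite !(dotC w) dotZl. Qed.

Lemma dotNl u w : dot (- u) w = - dot u w.
Proof. by rewrite -scaleN1r dotZl mulN1r. Qed.

Lemma dotNr u w : dot w (- u) = - dot w u.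
Proof. by rewrite !(dotC w) dotNl. Qed.

Lemma dot0l w : dot 0 w = 0.
Proof. by rewrite -(scale0r w) dotZl mul0r. Qed.

Lemma dot0r w : dot w 0 = 0.
Proof. by rewrite dotC dot0l. Qed.

Definition dotE := (dotDl, dotDr, dotNl, dotNr, dotZl, dotZr).

Lemma enorm_sqr u : enorm u ^+ 2 = dot u u.
Proof.
rewrite /enorm sqr_sqrtr; last by apply: sumr_ge0 => i _; exact: sqr_ge0.
by apply: eq_bigr => i _; rewrite expr2.
Qed.

Lemma enorm_ge0 u : 0 <= enorm u.
Proof. exact: sqrtr_ge0. Qed.

Lemma dot_ge0 u : 0 <= dot u u.
Proof. by rewrite -enorm_sqr sqr_ge0. Qed.

Lemma enorm0_eq0 u : enorm u = 0 -> u = 0.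
Proof.
move=> u0; have /eqP : dot u u = 0 by rewrite -enorm_sqr u0 expr0n.
rewrite psumr_eq0 => [/allP h|i _]; last by rewrite -expr2 sqr_ge0.
apply/matrixP => i j; rewrite (ord1 j) mxE.
by have := h i (mem_index_enum i); rewrite mulf_eq0 orbb => /eqP.
Qed.

Lemma enorm0 : enorm (0 : 'cV[R]_n) = 0.
Proof. by apply/eqP; rewrite -[_ == _]sqrf_eq0 enorm_sqr dot0l. Qed.

Lemma enormZ a u : enorm (a *: u) = `|a| * enorm u.
Proof.
apply/eqP; rewrite -(@eqrXn2 _ 2%N) ?mulr_ge0 ?enorm_ge0 //.
by rewrite exprMn !enorm_sqr !dotE real_normK ?num_real // expr2 mulrA.
Qed.

Lemma enormN u : enorm (- u) = enorm u.
Proof. by rewrite -scaleN1r enormZ normrN1 mul1r. Qed.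

Lemma enormB u v : enorm (u - v) = enorm (v - u).
Proof. by rewrite -enormN opprB. Qed.

Lemma cauchy_schwarz u v : dot u v <= enorm u * enorm v.
Proof.
have [/enorm0_eq0 ->|u0] := eqVneq (enorm u) 0.
  by rewrite dot0l mulr_ge0 ?enorm_ge0.
have [/enorm0_eq0 ->|v0] := eqVneq (enorm v) 0.
  by rewrite dot0r mulr_ge0 ?enorm_ge0.
have up : 0 < enorm u by rewrite lt_def u0 enorm_ge0.
have vp : 0 < enorm v by rewrite lt_def v0 enorm_ge0.
have := dot_ge0 (enorm v *: u - enorm u *: v).
rewrite !dotE (dotC v u) -!enorm_sqr => h.
rewrite -(ler_pM2l (mulr_gt0 up vp)).
nra.
Qed.

Lemma coord_le_enorm u i : `|u i 0| <= enorm u.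
Proof.
rewrite -(@ler_pXn2r _ 2%N) ?nnegrE ?enorm_ge0 //.
rewrite real_normK ?num_real // enorm_sqr /dot (bigD1 i) //= -expr2 lerDl.
by apply: sumr_ge0 => j _; rewrite -expr2 sqr_ge0.
Qed.

Lemma enorm_le_sum u : enorm u <= \sum_i `|u i 0|.
Proof.
have h0 : 0 <= \sum_i `|u i 0| by apply: sumr_ge0.
rewrite -(@ler_pXn2r _ 2%N) ?nnegrE ?enorm_ge0 // enorm_sqr expr2 mulr_suml.
apply: ler_sum => i _; rewrite (le_trans (ler_norm _)) // normrM ler_wpM2l //.
by rewrite (bigD1 i) //= lerDl sumr_ge0.
Qed.

Lemma dot_le_nneg y u v : (forall i, 0 <= y i 0) ->
  (forall i, u i 0 <= v i 0) -> dot y u <= dot y v.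
Proof. by move=> y0 uv; apply: ler_sum => i _; rewrite ler_wpM2l. Qed.

(** Compactness bounds the sup norm, and the Euclidean norm is at most the sum of the [n] absolute
    coordinates. *)
Lemma compact_enorm_bounded X : compact X ->
  exists2 b : R, 0 <= b & forall x, X x -> enorm x <= b.
Proof.
move=> /compact_bounded [b [_ hb]].
have [b' [b'0 hb']] : exists b' : R, 0 <= b' /\ forall x, X x -> `|x| <= b'.
  exists (Num.max b 0 + 1); split; first by rewrite addr_ge0 // le_max lexx orbT.
  by apply: hb; rewrite ltr_pwDr // le_max lexx.
exists (n%:R * b') => [|x Xx]; first by rewrite mulr_ge0.
apply: le_trans (enorm_le_sum x) _.
rewrite -[n in n%:R]card_ord mulr_natl -sumr_const.
apply: ler_sum => i _; apply: le_trans (hb' _ Xx).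
by rewrite [leRHS]mx_normrE; apply: (le_bigmax _ (fun p => `|x p.1 p.2|) (i, 0)).
Qed.

Lemma enorm_triangle u v : enorm (u + v) <= enorm u + enorm v.
Proof.
rewrite -(@ler_pXn2r _ 2%N) ?nnegrE ?addr_ge0 ?enorm_ge0 //.
rewrite enorm_sqr !dotE (dotC v u) sqrrD -!enorm_sqr.
have := cauchy_schwarz u v; lra.
Qed.

Lemma enormB_le_half_diam X x y : compact X -> X x -> X y ->
  enorm (x - y) <= 2 * half_diam X.
Proof.
move=> /compact_enorm_bounded [b b0 hb] Xx Xy.
rewrite /half_diam mulrC divfK // ub_le_sup //=; last by exists (x, y).
exists (b + b) => _ [[u v] [/= Xu Xv] <-].
by rewrite (le_trans (enorm_triangle _ _)) // enormN lerD // hb.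
Qed.

End EuclideanSpace.

(** * Subgradients and argmin conditions *)

Section Convexity.
Context {R : realType} {n : nat}.
Implicit Types (u v w x y z : 'cV[R]_n) (X : set 'cV[R]_n) (t : R).

Lemma convex_setP X x y t : convex_set X -> X x -> X y -> 0 <= t <= 1 ->
  X (t *: x + (1 - t) *: y).
Proof.
move=> cX Xx Xy /andP[t0 t1].
have := cX x y (Itv01 t0 t1); rewrite !inE => /(_ Xx Xy).
by rewrite /conv.
Qed.

Lemma convex_functionP X (h : 'cV[R]_n -> R) x y t :
  convex_function X h -> X x -> X y -> 0 <= t <= 1 ->
  h (t *: x + (1 - t) *: y) <= t * h x + (1 - t) * h y.
Proof.
move=> ch Xx Xy /andP[t0 t1].
by have := ch (Itv01 t0 t1) x y; rewrite !inE => /(_ Xx Xy).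
Qed.

Lemma cvg_coord (u : nat -> 'cV[R]_n) (a : 'cV[R]_n) i :
  u @ \oo --> a -> u j i 0 @[j --> \oo] --> a i 0.
Proof.
apply: (@continuous_cvg _ _ _ _ _ u (fun M : 'cV[R]_n => M i 0) a).
exact: coord_continuous.
Qed.

Lemma dot_cvg (u w : nat -> 'cV[R]_n) (a b : 'cV[R]_n) :
  u @ \oo --> a -> w @ \oo --> b -> dot (u j) (w j) @[j --> \oo] --> dot a b.
Proof.
move=> ua wb; apply: cvg_big => [|i _]; first exact: add_continuous.
by apply: cvgM; exact: cvg_coord.
Qed.

Lemma enorm_cvg (u : nat -> 'cV[R]_n) (a : 'cV[R]_n) :
  u @ \oo --> a -> enorm (u j) @[j --> \oo] --> enorm a.
Proof.
move=> ua; have := dot_cvg ua ua.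
rewrite -enorm_sqr => h.
have := @continuous_cvg _ _ _ _ _ (fun j => dot (u j) (u j)) Num.sqrt _
  (@sqrt_continuous R (enorm a ^+ 2)) h.
rewrite sqrtr_sqr ger0_norm ?enorm_ge0 //.
suff -> : Num.sqrt \o (fun j => dot (u j) (u j)) = (fun j => enorm (u j)).
  exact.
by apply/funext => j /=; rewrite -enorm_sqr sqrtr_sqr ger0_norm ?enorm_ge0.
Qed.

(* The upper model at interior points makes h lower semicontinuous along the
   sequence that defines a boundary element of the subdifferential. *)
Lemma subdiff_subgradient X (h : 'cV[R]_n -> R) L H x v :
  upper_model X h L H -> subdiff X h x v -> subgradient X h x v.
Proof.
move=> um [[]//|[Xx _ [u [w [uw ux wv]]]]] z Xz.
have hj j : h x + dot (w j) (z - x) <=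
    h z + (L / 2 * enorm (x - u j) ^+ 2 + H * enorm (x - u j)).
  have [riu sgu dsw] := uw j; have [Xu _] := riu.
  have := um x (u j) (w j) Xx Xu (or_introl (And3 riu sgu dsw)).
  have := sgu z Xz; rewrite !dotE; lra.
have xu : x - u j @[j --> \oo] --> (0 : 'cV[R]_n).
  by rewrite -(subrr x); apply: cvgB => //; exact: cvg_cst.
have e0 := enorm_cvg xu; rewrite enorm0 in e0.
have rhs : h z + (L / 2 * enorm (x - u j) ^+ 2 + H * enorm (x - u j))
    @[j --> \oo] --> h z + (L / 2 * 0 ^+ 2 + H * 0).
  apply: cvgD; first exact: cvg_cst.
  apply: cvgD.
    by apply: cvgM; [exact: cvg_cst|rewrite expr2; apply: cvgM].
  by apply: cvgM; first exact: cvg_cst.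
have lhs : h x + dot (w j) (z - x) @[j --> \oo] --> h x + dot v (z - x).
  apply: cvgD; first exact: cvg_cst.
  by apply: dot_cvg => //; exact: cvg_cst.
rewrite expr0n /= !mulr0 !addr0 in rhs.
by apply: (ler_cvg_to lhs rhs); exact: nearW.
Qed.

(** Replaces a differentiation at [t = 0]: optimality along a segment gives a first-order inequality
    up to a remainder [t * C], which is removed here without a limit. *)
Lemma le0_small (A C : R) : (forall t, 0 < t <= 1 -> A <= t * C) -> A <= 0.
Proof.
move=> h; case: (lerP A 0) => // A0.
have C0 : 0 < C by have := h 1; rewrite mul1r ltr01 lexx => /(_ isT); exact: lt_le_trans.
have AC : A <= C by have := h 1; rewrite mul1r ltr01 lexx => /(_ isT).
(* This point is at most 1 because [A <= C], and there the hypothesis reads [A <= A / 2]. *)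
have := h (A / (2 * C)).
have -> : A / (2 * C) * C = A / 2 by field; rewrite gt_eqF.
rewrite divr_gt0 ?mulr_gt0 //= ler_pdivrMr ?mulr_gt0 // mul1r.
have -> : A <= 2 * C by lra.
by move=> /(_ isT); lra.
Qed.

(** A competitor with finite [chi0] excludes +oo at the minimizer, and properness excludes -oo. *)
Lemma argmin_fin_num X (chi0 : 'cV[R]_n -> \bar R) (r : 'cV[R]_n -> R) z :
  proper_on X chi0 -> is_argmin X (fun u => (chi0 u + (r u)%:E)%E) z ->
  chi0 z \is a fin_num.
Proof.
move=> [pr [p Xp pfin]] [Xz /(_ p Xp)]; have := pr _ Xz; have := pr _ Xp.
by case: (chi0 z) (chi0 p) pfin => [a||] [b||].
Qed.

(** The prox inequality: the quadratic adds the growth [L / 2 |p - z|^2] away from the minimizer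
    [z]. Competing with [t p + (1 - t) z] and dividing by [t] leaves a first-order condition. *)
Lemma argmin_prox X (chi0 : 'cV[R]_n -> \bar R) (q : 'cV[R]_n -> R) c xh L z p :
  convex_set X -> econvex_on X chi0 -> proper_on X chi0 ->
  convex_function X q ->
  is_argmin X (fun u => (chi0 u +
    (q u + dot c u + L / 2 * enorm (u - xh) ^+ 2)%:E)%E) z ->
  X p -> chi0 p \is a fin_num ->
  fine (chi0 z) + q z + dot c z + L / 2 * enorm (z - xh) ^+ 2
    + L / 2 * enorm (p - z) ^+ 2
  <= fine (chi0 p) + q p + dot c p + L / 2 * enorm (p - xh) ^+ 2.
Proof.
move=> cX cchi pr cq zmin Xp pfin.
have zfin := argmin_fin_num pr zmin; case: zmin pr => Xz zmin [pr _].
(* By the three-point identity, [A] is exactly the left side minus the right side of the goal. *)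
set A := fine (chi0 z) + q z + dot c z - (fine (chi0 p) + q p + dot c p)
  - L * dot (p - z) (z - xh).
suff : A <= 0 by rewrite /A !enorm_sqr !dotE !(dotC _ z) !(dotC _ p); lra.
apply: (@le0_small _ (L / 2 * dot (p - z) (p - z))) => t /andP[t0 t1].
have t01 : 0 <= t <= 1 by rewrite t1 ltW.
have Xt := convex_setP cX Xp Xz t01.
have := zmin _ Xt; have := cchi p z t Xp Xz t01.
rewrite -(fineK zfin) -(fineK pfin) -!EFinM -!EFinD.
have : chi0 (t *: p + (1 - t) *: z) != -oo%E by exact: pr.
case: (chi0 _) => //= r _; rewrite -!EFinD !lee_fin => hr hm.
have hq := convex_functionP cq Xp Xz t01.
rewrite -(ler_pM2l t0) /A.
have e : enorm (t *: p + (1 - t) *: z - xh) ^+ 2 = enorm (z - xh) ^+ 2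
   + 2 * t * dot (p - z) (z - xh) + t ^+ 2 * dot (p - z) (p - z).
  by rewrite !enorm_sqr !dotE !(dotC _ z) !(dotC _ p); ring.
rewrite e in hm; move: hm hq; rewrite (dotDr (t *: p)) !dotZr.
set d1 := dot (p - z) (z - xh); set d2 := dot (p - z) (p - z).
nra.
Qed.

(** [y] is minus the gradient of the objective at [s], so optimality over the nonpositive orthant
    reads [<y, s' - s> <= 0]. Testing [s' = s - e_i] gives [y >= 0], and [s' = 0] gives the
    slackness half [<y, s> >= 0]. In the method [y] is the multiplier y_{k+1}. *)
Lemma argmin_slack (u w s : 'cV[R]_n) (rho : R) :
  is_argmin [set s : 'cV[R]_n | forall i, s i 0 <= 0]
    (fun s => dot (- u) s + rho / 2 * enorm (w - s) ^+ 2) s ->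
  let y := u + rho *: (w - s) in (forall i, 0 <= y i 0) /\ 0 <= dot y s.
Proof.
move=> [sle smin] y.
have vi (s' : 'cV[R]_n) : (forall i, s' i 0 <= 0) -> dot y (s' - s) <= 0.
  move=> s'le; apply: (@le0_small _ (rho / 2 * dot (s' - s) (s' - s))) => t /andP[t0 t1].
  have := smin (t *: s' + (1 - t) *: s).
  have -> : enorm (w - (t *: s' + (1 - t) *: s)) ^+ 2 = enorm (w - s) ^+ 2
     - 2 * t * dot (w - s) (s' - s) + t ^+ 2 * dot (s' - s) (s' - s).
    by rewrite !enorm_sqr !dotE !(dotC _ s) !(dotC _ s') !(dotC _ w); ring.
  have -> : dot (- u) (t *: s' + (1 - t) *: s)
     = dot (- u) s - t * dot u (s' - s) by rewrite !dotE; ring.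
  have /[swap]/[apply] : forall i, (t *: s' + (1 - t) *: s) i 0 <= 0.
    by move=> i; rewrite !mxE; have := sle i; have := s'le i; nra.
  move=> h; rewrite -(ler_pM2l t0) /y (dotDl u) (dotZl rho (w - s)); lra.
split=> [i|].
  have := vi (s - delta_mx i 0).
  rewrite addrAC subrr add0r dotNr /dot (bigD1 i) //= big1 => [|j ji].
    rewrite addr0 !mxE !eqxx mulr1 oppr_le0; apply=> j; rewrite !mxE.
    by rewrite subr_le0 (le_trans (sle j)) ?ler0n.
  by rewrite !mxE (negbTE ji) mulr0.
have := vi 0; rewrite sub0r dotNr oppr_le0; apply=> i; by rewrite mxE.
Qed.

End Convexity.

(** * One iteration *)

Section DescentStep.
Context {R : realType} {n m : nat}.

Lemma dot_mulmx_tr (A : 'M[R]_(n, m)) (y : 'cV[R]_m) (z : 'cV[R]_n) :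
  dot (A *m y) z = dot y (A^T *m z).
Proof.
transitivity (\sum_i \sum_j A i j * y j 0 * z i 0).
  by apply: eq_bigr => i _; rewrite mxE mulr_suml.
rewrite exchange_big /=; apply: eq_bigr => j _; rewrite mxE mulr_sumr.
by apply: eq_bigr => i _; rewrite mxE mulrCA mulrA.
Qed.

Lemma tr_mulmx_coord (A : 'M[R]_(n, m)) (z : 'cV[R]_n) i :
  (A^T *m z) i 0 = dot (col i A) z.
Proof. by rewrite mxE; apply: eq_bigr => j _; rewrite !mxE. Qed.

(** An exact identity linking the two dual updates, with steps [rho] and [eta], of the same
    multiplier [t]. It exchanges the computed multiplier for an arbitrary [y]; the last term is
    nonnegative once [eta <= 2 rho]. *)
Lemma dual_step (t u y : 'cV[R]_m) (rho eta : R) : 0 < eta ->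
  dot (t + rho *: u) u = dot y u
    + (enorm (t + eta *: u - y) ^+ 2 - enorm (t - y) ^+ 2) / (2 * eta)
    + (rho - eta / 2) * dot u u.
Proof.
move=> eta0; rewrite !enorm_sqr !dotE (dotC u y) (dotC u t) (dotC t y).
by field; rewrite gt_eqF.
Qed.

Context (X : set 'cV[R]_n) (f : 'cV[R]_n -> R) (chi0 : 'cV[R]_n -> \bar R).
Context (g chi : 'cV[R]_n -> 'cV[R]_m).
Context (f' : 'cV[R]_n -> 'cV[R]_n) (g' : 'cV[R]_n -> 'M[R]_(n, m)).
Context (Lf Hf : R) (Lg Hg : 'cV[R]_m).

Lemma dot_convex_on (y : 'cV[R]_m) : (forall i, 0 <= y i 0) ->
  (forall i, convex_function X (fun x => chi x i 0)) ->
  convex_function X (fun x => dot y (chi x)).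
Proof.
move=> y0 cchi t a b /set_mem Xa /set_mem Xb.
change (dot y (chi (t%:num *: a + (1 - t%:num) *: b)) <=
  t%:num * dot y (chi a) + (1 - t%:num) * dot y (chi b)).
have t01 : 0 <= t%:num <= 1 by apply/andP.
rewrite -!dotZr -dotDr; apply: dot_le_nneg => // i; rewrite !mxE.
exact: convex_functionP (cchi i) Xa Xb t01.
Qed.

(** The coordinatewise upper models are combined with the nonnegative weights [y]; Cauchy-Schwarz
    against the vectors [Lg] and [Hg] of constants produces the aggregated L_g and H_g. *)
Lemma model_gap_dot (y : 'cV[R]_m) (xh x : 'cV[R]_n) :
  (forall i, 0 <= y i 0) -> (forall i, 0 <= Lg i 0) -> (forall i, 0 <= Hg i 0) ->
  (forall i, upper_model X (fun x => g x i 0) (Lg i 0) (Hg i 0)) ->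
  (forall x i, X x -> subdiff X (fun z => g z i 0) x (col i (g' x))) ->
  X xh -> X x ->
  dot y (g x - linearization g g' xh x) <=
    enorm y * (enorm Lg / 2 * enorm (x - xh) ^+ 2 + enorm Hg * enorm (x - xh)).
Proof.
move=> y0 Lg0 Hg0 um sd Xxh Xx.
apply: (@le_trans _ _ (dot y ((enorm (x - xh) ^+ 2 / 2) *: Lg + enorm (x - xh) *: Hg))).
  apply: dot_le_nneg => // i; rewrite !mxE.
  have := um i x xh _ Xx Xxh (sd xh i Xxh).
  rewrite /linearization -tr_mulmx_coord !mxE; lra.
have e0 := enorm_ge0 (x - xh).
rewrite !dotE; have := cauchy_schwarz y Lg; have := cauchy_schwarz y Hg.
move=> hH hL; have e2 : 0 <= enorm (x - xh) ^+ 2 / 2 by rewrite divr_ge0 ?sqr_ge0.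
have := ler_wpM2l e0 hH; have := ler_wpM2l e2 hL; lra.
Qed.

(** [st_V b] differs from the constraint value by [- st_s b >= 0], so it may stand in for the
    constraint wherever a nonnegative multiplier is applied. *)
Lemma aug_conex_step_invariants (a b : state R n m) rho eta L tau beta G :
  proper_on X chi0 ->
  aug_conex_step X chi0 g chi g' rho eta L tau beta G a b ->
  [/\ X (st_x b), chi0 (st_x b) \is a fin_num &
      forall i, psi g chi (st_x b) i 0 <= st_V b i 0].
Proof.
move=> pr [[sle _] [xmin [_ [-> _]]]]; split; first exact: (proj1 xmin).
  exact: argmin_fin_num pr xmin.
by move=> i; rewrite /psi !mxE lerDl oppr_ge0; exact: sle.
Qed.

(** The prox inequality at [p] is combined with convexity of the model and the dual identity.
    Finiteness of [chi0 (st_x a)] is asked only for [tau != 1]: otherwise the default value taken by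
    [fine] is multiplied by 0. *)
Lemma aug_conex_step_bound (a b : state R n m) rho eta L tau beta G
    (xs : 'cV[R]_n) (y : 'cV[R]_m) :
  let phi x := f x + fine (chi0 x) in
  let p := (1 - tau) *: st_x a + tau *: xs in
  let xh := st_xhat a in
  let gap := enorm (st_x b - xh) in
  convex_set X -> convex_function X f ->
  (forall i, convex_function X (fun x => g x i 0)) ->
  econvex_on X chi0 -> proper_on X chi0 ->
  (forall i, convex_function X (fun x => chi x i 0)) ->
  (forall i, 0 <= Lg i 0) -> (forall i, 0 <= Hg i 0) ->
  upper_model X f Lf Hf ->
  (forall i, upper_model X (fun x => g x i 0) (Lg i 0) (Hg i 0)) ->
  (forall x, X x -> subdiff X f x (f' x)) ->
  (forall x i, X x -> subdiff X (fun z => g z i 0) x (col i (g' x))) ->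
  aug_conex_step X chi0 g chi g' rho eta L tau beta G a b ->
  X (st_x a) -> X xh -> 0 <= tau <= 1 ->
  (tau != 1 -> chi0 (st_x a) \is a fin_num) ->
  (forall i, psi g chi (st_x a) i 0 <= st_V a i 0) ->
  0 < rho -> 0 < eta -> eta <= 2 * rho ->
  X xs -> chi0 xs \is a fin_num -> (forall i, psi g chi xs i 0 <= 0) ->
  (forall i, 0 <= y i 0) ->
  phi (st_x b) - phi xs + dot y (st_V b) <=
    (1 - tau) * (phi (st_x a) - phi xs + dot y (st_V a))
    + L / 2 * (enorm (p - xh) ^+ 2 - enorm (p - st_x b) ^+ 2)
    + (enorm (st_ytilde a - y) ^+ 2 - enorm (st_ytilde b - y) ^+ 2) / (2 * eta)
    - (L - Lf - enorm y * enorm Lg) / 2 * gap ^+ 2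
    + (Hf + enorm y * enorm Hg) * gap
    + dot (G - f' xh) (p - st_x b).
Proof.
move=> phi p xh gap cX cf cg cchi0 pr cchi Lg0 Hg0 umf umg sdf sdg.
case=> smin [xmin [yb [Vb [ytb _]]]] Xa Xxh tau01 fina psia rho0 eta0 etarho Xs fins psis y0.
have [yb0 yb_s] := argmin_slack smin.
set W := (1 - tau) *: st_V a in smin yb ytb yb0 yb_s *.
set Vt := linearization g g' xh (st_x b) + chi (st_x b) - st_s b in yb ytb.
set U := Vt - W.
have ybE : st_ytilde a + rho *: (linearization g g' xh (st_x b) + chi (st_x b) - W - st_s b) = st_y b.
  by rewrite yb; congr (_ + _ *: _); rewrite /Vt addrAC.
rewrite {}ybE in yb0 yb_s.
have Xb : X (st_x b) := proj1 xmin.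
have pE : p = tau *: xs + (1 - tau) *: st_x a by rewrite /p addrC.
have Xp : X p by rewrite pE; exact: convex_setP.
have tau0 : 0 <= tau by case/andP: tau01.
have tau1 : 0 <= 1 - tau by rewrite subr_ge0; case/andP: tau01.
have [pfin pchi] : chi0 p \is a fin_num /\
    fine (chi0 p) <= (1 - tau) * fine (chi0 (st_x a)) + tau * fine (chi0 xs).
  have := proj1 pr _ Xp; rewrite /p.
  have [tau1E|tauN1] := eqVneq tau 1.
    by rewrite tau1E subrr scale0r scale1r add0r mul0r mul1r add0r.
  have := cchi0 xs (st_x a) tau Xs Xa tau01; rewrite -pE /p.
  rewrite -(fineK fins) -(fineK (fina tauN1)) -!EFinM -EFinD.
  by case: (chi0 _) => //= r; rewrite lee_fin addrC.
have pf : f p <= (1 - tau) * f (st_x a) + tau * f xs.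
  by rewrite pE [leRHS]addrC; exact: convex_functionP.
have prox := argmin_prox cX cchi0 pr (dot_convex_on yb0 cchi) xmin Xp pfin.
have ub := umf _ _ _ Xb Xxh (sdf _ Xxh).
have sub := subdiff_subgradient umf (sdf _ Xxh) Xp.
(* At [p] the linearization lies below [g]; convexity, feasibility of [xs] and
   [psi (st_x a) <= st_V a] then bound each coordinate by [(1 - tau) V], and the computed multiplier
   is nonnegative. *)
have gp : dot (st_y b) (linearization g g' xh p + chi p) <= (1 - tau) * dot (st_y b) (st_V a).
  rewrite -dotZr; apply: dot_le_nneg => // i.
  have sg := subdiff_subgradient (umg i) (sdg _ i Xxh) Xp.
  have cgi := convex_functionP (cg i) Xs Xa tau01.
  have cci := convex_functionP (cchi i) Xs Xa tau01.
  rewrite -pE in cgi cci.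
  have := psia i; have := psis i; rewrite -tr_mulmx_coord in sg.
  rewrite !mxE in sg *; move: sg cgi cci; nra.
have yU : dot (st_y b) U = dot y U
   + (enorm (st_ytilde b - y) ^+ 2 - enorm (st_ytilde a - y) ^+ 2) / (2 * eta)
   + (rho - eta / 2) * dot U U.
  by rewrite yb ytb; exact: dual_step.
have UU := dot_ge0 U.
have gapV := model_gap_dot y0 Lg0 Hg0 umg sdg Xxh Xb.
(* [V] and [Vtilde] differ by the linearization error of [g]. It is added after [y] has replaced
   [st_y b], so its cost involves [enorm y] only. *)
have VE : st_V b = Vt + (g (st_x b) - linearization g g' xh (st_x b)).
  by rewrite Vb /Vt; apply/matrixP => i j; rewrite !mxE; ring.
have UE : dot (st_y b) U = dot (st_y b) (linearization g g' xh (st_x b) + chi (st_x b))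
    - dot (st_y b) (st_s b) - (1 - tau) * dot (st_y b) (st_V a).
  by rewrite /U /Vt /W !dotE.
have yUE : dot y U = dot y Vt - (1 - tau) * dot y (st_V a) by rewrite /U /W !dotE.
have rU : 0 <= (rho - eta / 2) * dot U U by apply: mulr_ge0 => //; lra.
rewrite VE (dotDr Vt) /phi.
(* Up to terms free of [z], the linear part of the subproblem is the linearized constraint weighted
   by [st_y b]. *)
have lin (z : 'cV[R]_n) : dot (G + g' xh *m st_y b) z = dot G z - dot (st_y b) (g xh)
   + dot (st_y b) (linearization g g' xh z) + dot (st_y b) ((g' xh)^T *m xh).
  rewrite dotDl dot_mulmx_tr /linearization mulmxBr !dotE; ring.
rewrite !lin -!/xh in prox.
rewrite -/xh -/gap in prox ub gapV.
rewrite (enormB p (st_x b)).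
rewrite (enormB p (st_x b)) in prox.
rewrite (dotDr _ _ (st_y b)) in gp; rewrite (dotDr _ _ (st_y b)) in UE.
move: prox ub sub pf pchi gp yU gapV UE yUE rU yb_s.
clearbody p.
rewrite !(dotDl G) !dotNl !(dotDr p) !(dotDr (st_x b)) !dotNr.
lra.
Qed.

End DescentStep.

(** * The momentum potential *)

Section Momentum.
Context {R : realType} {n : nat}.
Implicit Types (u e v : 'cV[R]_n).

Definition momentum_potential (k : R) u v : R :=
  dot u u - 2 / k * dot u v + k^-1 * dot v v.

Lemma momentum_potential_ge0 (k : R) u v : 1 <= k -> 0 <= momentum_potential k u v.
Proof.
move=> k1; have k0 : 0 < k by lra.
have -> : momentum_potential k u v =
    dot (u - k^-1 *: v) (u - k^-1 *: v) + (k - 1) / k ^+ 2 * dot v v.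
  by rewrite /momentum_potential !dotE (dotC v u); field; rewrite gt_eqF.
rewrite addr_ge0 ?dot_ge0 // mulr_ge0 ?dot_ge0 // divr_ge0 ?sqr_ge0 //; lra.
Qed.

(** Times [k (k + 1)], the right side minus the left side is a nonnegative combination of [|X|^2],
    [|Y|^2] and [|v|^2], with [X] and [Y] as below. The price is a multiple of [|v|^2] with a
    summable coefficient. *)
Lemma momentum_potential_step (k : R) u u' v v' : 1 <= k ->
  (k + 1) *: v' = (k - 1) *: v + 2 *: u' ->
  k / (k + 1) * (dot u u - dot u' u' - dot (u' - u) (u' - u) / 2) <=
    momentum_potential k u v - momentum_potential (k + 1) u' v'
    + 13 / 4 / (k * (k + 1)) * dot v v.
Proof.
move=> k1 hv'; have k0 : 0 < k by lra.
have kp0 : 0 < k + 1 by lra.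
have -> : v' = ((k - 1) / (k + 1)) *: v + (2 / (k + 1)) *: u'.
  apply: (@scalerI _ _ (k + 1)); first by rewrite gt_eqF.
  by rewrite hv' scalerDr !scalerA ![(k + 1) * (_ / _)]mulrC !divfK // gt_eqF.
have [e ->] : exists e, u' = u + e by exists (u' - u); rewrite addrC subrK.
(* Complete the square in u, which produces q, then in e, which produces a. *)
pose q := 5 * k ^+ 2 + 2 * k + 1.
pose a := k ^+ 2 + 2 * k - 1.
have a0 : 0 < a by rewrite /a; nra.
pose X := u - ((k - 1) ^+ 2 / (4 * k)) *: e - (q / (4 * k ^+ 2)) *: v.
pose Y := e - ((k - 1) ^+ 2 / (k * a)) *: v.
rewrite -subr_ge0.
(* [q <= 8 k^2], with equality at [k = 1], and [(k - 1)^4 <= k^2 a]; hence 13/4 exceeds the sum of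
   the bounds 2 and 1. *)
have c0 : 0 <= 13 / 4 - q / (4 * k ^+ 2) - (k - 1) ^+ 4 / (4 * k ^+ 2 * a).
  have h1 : q / (4 * k ^+ 2) <= 2.
    by rewrite ler_pdivrMr ?mulr_gt0 ?exprn_gt0 // /q; nra.
  have h2 : (k - 1) ^+ 4 / (4 * k ^+ 2 * a) <= 1.
    rewrite ler_pdivrMr ?mulr_gt0 ?exprn_gt0 // mul1r.
    have : (k - 1) ^+ 2 <= k ^+ 2 by nra.
    have : (k - 1) ^+ 2 <= a by rewrite /a; nra.
    rewrite (_ : 4%N = 2 + 2)%N // exprD => h3 h4.
    have := ler_pM (sqr_ge0 (k - 1)) (sqr_ge0 (k - 1)) h4 h3.
    have := mulr_ge0 (sqr_ge0 k) (ltW a0); lra.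
  lra.
have : 0 <= (4 * k ^+ 2 / (k + 1) ^+ 2 * dot X X + a / 4 * dot Y Y
   + (13 / 4 - q / (4 * k ^+ 2) - (k - 1) ^+ 4 / (4 * k ^+ 2 * a)) * dot v v)
   / (k * (k + 1)).
  apply: divr_ge0; last by apply: mulr_ge0; apply: ltW.
  apply: addr_ge0; last exact: mulr_ge0 c0 (dot_ge0 v).
  apply: addr_ge0; apply: mulr_ge0 (dot_ge0 _); last by lra.
  by rewrite divr_ge0 ?sqr_ge0 // mulr_ge0 ?sqr_ge0.
move=> h; apply: (le_trans h); rewrite le_eqVlt; apply/orP; left; apply/eqP.
rewrite /X /Y /momentum_potential !dotE !(dotC v e) !(dotC v u) !(dotC e u) /q.
have aE : a = k ^+ 2 + 2 * k - 1 by [].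
field: aE.
by rewrite !gt_eqF.
Qed.

(** After telescoping the potential, the remainders add up to [13/4 c] times a sum of
    [1/k - 1/(k + 1)], which is below 1. The bound [c] concerns the averages [x], not the points
    [z]. *)
Lemma momentum_sum (x z : nat -> 'cV[R]_n) (xs : 'cV[R]_n) (c : R) K :
  (0 < K)%N -> z 1%N = x 1%N ->
  (forall k, (0 < k < K)%N ->
     (k%:R + 1) *: x k.+1 = (k%:R - 1) *: x k + 2 *: z k.+1) ->
  (forall k, (0 < k <= K)%N -> enorm (x k - xs) ^+ 2 <= c) ->
  \sum_(1 <= k < K) k%:R / (k%:R + 1) *
    (enorm (z k - xs) ^+ 2 - enorm (z k.+1 - xs) ^+ 2
     - enorm (z k.+1 - z k) ^+ 2 / 2) <= 13 / 4 * c.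
Proof.
move=> K0 z1 xz xc.
have c0 : 0 <= c by apply: le_trans (xc 1%N _); rewrite ?sqr_ge0.
pose Phi k := momentum_potential k%:R (z k - xs) (x k - xs).
have H N : (N < K)%N -> \sum_(1 <= k < N.+1) k%:R / (k%:R + 1) *
    (enorm (z k - xs) ^+ 2 - enorm (z k.+1 - xs) ^+ 2
     - enorm (z k.+1 - z k) ^+ 2 / 2)
    <= 13 / 4 * c * (1 - (N.+1%:R)^-1) - Phi N.+1.
  elim: N => [_|N IH NK].
    (* At [k = 1] the potential is [|u - v|^2], which vanishes since [z 1 = x 1]; no initial
       distance is left. *)
    rewrite big_geq // /Phi /momentum_potential z1; lra.
  rewrite big_nat_recr //=; apply: le_trans (lerD (IH (ltnW NK)) (lexx _)) _.
  have k1 : (1 : R) <= N.+1%:R by rewrite ler1n.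
  have e : (N.+1%:R + 1) *: (x N.+2 - xs) =
      (N.+1%:R - 1) *: (x N.+1 - xs) + 2 *: (z N.+2 - xs).
    apply/matrixP => i j; have := congr1 (fun A : 'cV[R]_n => A i j) (xz N.+1 NK).
    rewrite !mxE; lra.
  have := momentum_potential_step (z N.+1 - xs) k1 e.
  rewrite (_ : z N.+2 - xs - (z N.+1 - xs) = z N.+2 - z N.+1); last first.
    by rewrite opprB addrA subrK.
  rewrite -!enorm_sqr natr1 -/(Phi _) -/(Phi N.+2).
  have := xc N.+1 (ltnW NK).
  rewrite -[N.+2%:R]natr1; set k : R := N.+1%:R => vc h.
  have h2 : 13 / 4 / (k * (k + 1)) * enorm (x N.+1 - xs) ^+ 2 <=
      13 / 4 * c * (k^-1 - (k + 1)^-1).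
    have -> : 13 / 4 * c * (k^-1 - (k + 1)^-1) = 13 / 4 / (k * (k + 1)) * c.
      by field; rewrite !gt_eqF //; lra.
    apply: ler_wpM2l vc; rewrite divr_ge0 ?mulr_ge0 //; lra.
  apply: le_trans (lerD (lexx _) (le_trans h (lerD (lexx _) h2))) _.
  by rewrite le_eqVlt; apply/orP; left; apply/eqP; ring.
case: K K0 xz xc H => // N _ xz xc /(_ N (leqnn _)) h; apply: (le_trans h).
have p0 : 0 <= Phi N.+1 by apply: momentum_potential_ge0; rewrite ler1n.
have : 0 <= 13 / 4 * c * N.+1%:R^-1 by rewrite !mulr_ge0.
by rewrite mulrBr mulr1 -addrA gerDl -opprD oppr_le0 => ?; exact: addr_ge0.
Qed.

(** Abel summation: each later [b k] gets the coefficient [c k - c k.-1 <= 0]. *)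
Lemma nonincreasing_weight_sum (c b : nat -> R) K : (1 < K)%N ->
  (forall k, (0 < k < K)%N -> 0 <= c k) ->
  (forall k, (0 < k)%N -> (k.+1 < K)%N -> c k.+1 <= c k) ->
  (forall k, 0 <= b k) ->
  \sum_(1 <= k < K) c k * (b k - b k.+1) <= c 1%N * b 1%N.
Proof.
move=> K1 c0 cd b0.
have H N : (0 < N)%N -> (N < K)%N ->
    \sum_(1 <= k < N.+1) c k * (b k - b k.+1) <= c 1%N * b 1%N - c N * b N.+1.
  elim: N => // -[|N] IH _ NK; first by rewrite big_nat1 mulrBr.
  rewrite big_nat_recr //=; apply: le_trans (lerD (IH isT (ltnW NK)) (lexx _)) _.
  have := ler_wpM2r (b0 N.+2) (cd N.+1 isT NK); lra.
case: K K1 c0 cd H => // -[//|N] _ c0 cd /(_ N.+1 isT (leqnn _)) h.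
apply: (le_trans h); by rewrite gerBl mulr_ge0 // c0 ?leqnn.
Qed.

(** [w 0 = 0] removes the initial gap [Q 1], which in the method may contain a default [fine] value
    of [chi0] at x_1. *)
Lemma weighted_telescope (Q r w : nat -> R) K : (1 < K)%N -> w 0%N = 0 ->
  (forall k, (0 < k < K)%N -> w k * Q k.+1 <= w k.-1 * Q k + r k) ->
  w K.-1 * Q K <= \sum_(1 <= k < K) r k.
Proof.
move=> K1 w0 h.
have H N : (N < K)%N -> w N * Q N.+1 <= \sum_(1 <= k < N.+1) r k.
  elim: N => [_|N IH NK]; first by rewrite w0 mul0r big_geq.
  rewrite big_nat_recr //=; apply: (le_trans (h N.+1 NK)).
  by rewrite lerD2r IH // ltnW.
case: K K1 h H => // N _ h /(_ N (leqnn _)); exact.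
Qed.

End Momentum.

(** * A deterministic run *)

Section DeterministicRun.
Context {R : realType} {n m : nat}.
Context (X : set 'cV[R]_n) (f : 'cV[R]_n -> R) (chi0 : 'cV[R]_n -> \bar R).
Context (g chi : 'cV[R]_n -> 'cV[R]_m).
Context (f' : 'cV[R]_n -> 'cV[R]_n) (g' : 'cV[R]_n -> 'M[R]_(n, m)).
Context (Lf Hf : R) (Lg Hg : 'cV[R]_m).
Context (xs : 'cV[R]_n) (K : nat) (B rho1 Lk : R).
Context (tau rho eta beta : nat -> R).
Context (st : nat -> state R n m) (G : nat -> 'cV[R]_n).

Context (cX : convex_set X) (kX : compact X) (cf : convex_function X f).
Context (cg : forall i, convex_function X (fun x => g x i 0)).
Context (cchi0 : econvex_on X chi0) (pr : proper_on X chi0).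
Context (cchi : forall i, convex_function X (fun x => chi x i 0)).
Context (Lg0 : forall i, 0 <= Lg i 0) (Hg0 : forall i, 0 <= Hg i 0).
Context (umf : upper_model X f Lf Hf).
Context (umg : forall i, upper_model X (fun x => g x i 0) (Lg i 0) (Hg i 0)).
Context (sdf : forall x, X x -> subdiff X f x (f' x)).
Context (sdg : forall x i, X x -> subdiff X (fun z => g z i 0) x (col i (g' x))).
Context (Xs : X xs) (fins : chi0 xs \is a fin_num).
Context (psis : forall i, psi g chi xs i 0 <= 0).
Context (K2 : (2 <= K)%N) (rho10 : 0 < rho1) (rho_1 : rho 1%N = rho1).
Context (tauE : forall k, (0 < k <= K)%N -> tau k = 2 / (k%:R + 1)).
Context (rhoE : forall k, (0 < k < K)%N -> rho k.+1 = rho1 * (k%:R + 2)).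
Context (etaE : forall k, (0 < k < K)%N -> eta k = rho1 * (k%:R ^+ 2 / K%:R)).
Context (betaE : forall k, (0 < k < K)%N ->
  beta k.+1 = (1 - tau k) * tau k.+1 / tau k).
Context (Xx1 : X (st_x (st 1%N))) (xh1 : st_xhat (st 1%N) = st_x (st 1%N)).
Context (V1 : st_V (st 1%N) = psi g chi (st_x (st 1%N))).
Context (steps : forall k, (0 < k < K)%N ->
  aug_conex_step X chi0 g chi g' (rho k) (eta k) Lk (tau k) (beta k.+1) (G k)
    (st k) (st k.+1)).
Context (Xxh : forall k, (0 < k < K)%N -> X (st_xhat (st k))).
Context (L'0 : 0 < Lk - 2 * Lf - 2 * B * enorm Lg).

Let x k := st_x (st k).
Let phi u := f u + fine (chi0 u).

(* The auxiliary iterates z_k with x_{k+1} = (1 - tau_k) x_k + tau_k z_{k+1}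
   and hat x_k = (1 - tau_k) x_k + tau_k z_k. *)
Let z k := if (k <= 1)%N then x 1%N
  else x k.-1 + (k%:R / 2) *: (x k - x k.-1).

Let zS k : (0 < k)%N -> z k.+1 = x k + ((k%:R + 1) / 2) *: (x k.+1 - x k).
Proof. by case: k => // k _; rewrite /z /= natr1. Qed.

Let x_rec k : (0 < k < K)%N ->
  (k%:R + 1) *: x k.+1 = (k%:R - 1) *: x k + 2 *: z k.+1.
Proof.
by case/andP=> k0 _; rewrite zS //; apply/matrixP => i j; rewrite !mxE; lra.
Qed.

(** This is what the choice of [beta] achieves: [tau_{k+1} (z_{k+1} - x_{k+1})] equals [tau_{k+1} (1
    / tau_k - 1) (x_{k+1} - x_k)]. At [k = 1] all three points coincide. *)
Let xhat_z k : (0 < k < K)%N ->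
  st_xhat (st k) = (1 - tau k) *: x k + tau k *: z k.
Proof.
case: k => // -[|k] kK.
  by rewrite xh1 /z /= -/(x 1%N) -scalerDl subrK scale1r.
have kK' : (0 < k.+1 < K)%N by rewrite /= ltnW.
have [_ [_ [_ [_ [_ ->]]]]] := steps kK'.
have t1 : tau k.+1 = 2 / (k.+1%:R + 1) by rewrite tauE //= ltnW // ltnW.
have t2 : tau k.+2 = 2 / (k.+2%:R + 1) by rewrite tauE //= ltnW.
rewrite betaE // t1 t2 zS //.
apply/matrixP => i j; rewrite !mxE -/(x k.+1) -/(x k.+2).
rewrite -[k.+2%:R]natr1; set c : R := k.+1%:R.
have c0 : 0 < c by rewrite ltr0n.
by field; rewrite !gt_eqF //; lra.
Qed.

(** [chi0] is finite only from [k = 2] on: later iterates are minimizers, whereas x_1 is any point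
    of [X]. *)
Lemma run_invariants k : (0 < k <= K)%N ->
  [/\ X (x k), ((1 < k)%N -> chi0 (x k) \is a fin_num) &
      forall i, psi g chi (x k) i 0 <= st_V (st k) i 0].
Proof.
case: k => // -[_|k kK]; first by split=> // i; rewrite V1.
have [] := aug_conex_step_invariants pr (steps (k := k.+1) kK).
by split.
Qed.

Let target k := (1 - tau k) *: x k + tau k *: xs.
Let delta k := G k - f' (st_xhat (st k)).
Let D := half_diam X.
(** Four times the coefficient of [gap^2] that remains after [Lk / 4] has gone to the momentum terms
    and the errors of [f] and, for multipliers of norm [B], of [g] are paid. *)
Let L' := Lk - 2 * Lf - 2 * B * enorm Lg.

Lemma quadratic_noise_bound (a L0 t : R) : 0 < L0 -> a * t <= L0 / 4 * t ^+ 2 + a ^+ 2 / L0.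
Proof.
move=> L00; rewrite -subr_ge0.
have -> : L0 / 4 * t ^+ 2 + a ^+ 2 / L0 - a * t = (L0 * t / 2 - a) ^+ 2 / L0.
  by field; rewrite gt_eqF.
by rewrite divr_ge0 ?sqr_ge0 // ltW.
Qed.

(** [h] bounds the coefficient of the terms linear in [gap]. Young's inequality sets
    [(h + |delta|) gap] against [L' / 4 gap^2] and leaves [(h + |delta|)^2 / L']. *)
Lemma run_step_bound (y : 'cV[R]_m) (h : R) k : (0 < k < K)%N ->
  (forall i, 0 <= y i 0) ->
  Hf + enorm y * enorm Hg + enorm Lg * D * Num.max (enorm y - B) 0 <= h ->
  phi (x k.+1) - phi xs + dot y (st_V (st k.+1)) <=
    (1 - tau k) * (phi (x k) - phi xs + dot y (st_V (st k)))
    + Lk / 2 * tau k ^+ 2 * (enorm (z k - xs) ^+ 2 - enorm (z k.+1 - xs) ^+ 2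
        - enorm (z k.+1 - z k) ^+ 2 / 2)
    + (enorm (st_ytilde (st k) - y) ^+ 2 - enorm (st_ytilde (st k.+1) - y) ^+ 2) / (2 * eta k)
    + ((h + enorm (delta k)) ^+ 2 / L'
       + dot (delta k) (target k - st_xhat (st k))).
Proof.
move=> kK y0 hh; have /andP[k0 kK1] := kK.
have kK2 : (0 < k <= K)%N by rewrite k0 ltnW.
have [Xk fink psik] := run_invariants kK2.
have [XSk _ _] : [/\ X (x k.+1), _ & _] := run_invariants (k := k.+1) kK1.
have kr : (1 : R) <= k%:R by rewrite ler1n.
have tau01 : 0 <= tau k <= 1.
  by rewrite tauE // divr_ge0 ?addr_ge0 //= ler_pdivrMr; lra.
(* [tau 1 = 1], so [tau k != 1] forces [1 < k]. *)
have fina : tau k != 1 -> chi0 (x k) \is a fin_num.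
  move=> tk; apply: fink; rewrite ltn_neqAle k0 andbT; apply: contraNneq tk => <-.
  by rewrite tauE ?(ltnW K2) // divff // gt_eqF.
have K0 : (0 : R) < K%:R by rewrite ltr0n (leq_trans _ K2).
have etak : 0 < eta k by rewrite etaE // mulr_gt0 // divr_gt0 ?exprn_gt0 //; lra.
(* With [k <= K] this gives [eta k <= rho1 k <= 2 rho k], the sign condition of the dual step. *)
have rhok : rho1 * k%:R <= rho k.
  case: k k0 {kr etak kK fina tau01 fink XSk Xk psik kK1} kK2 => // -[_ _|k _ kK2].
    by rewrite rho_1 mulr1.
  by rewrite rhoE // ler_pM2l // -[k.+2%:R]natr1; lra.
have rhok0 : 0 < rho k by apply: lt_le_trans rhok; rewrite mulr_gt0 //; lra.
have etarho : eta k <= 2 * rho k.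
  apply: (@le_trans _ _ (rho1 * k%:R)); last by lra.
  rewrite etaE // ler_pM2l // ler_pdivrMr // expr2 ler_wpM2l ?ler_nat //.
  exact: ltnW.
have := aug_conex_step_bound cX cf cg cchi0 pr cchi Lg0 Hg0 umf umg sdf sdg
  (steps kK) Xk (Xxh kK) tau01 fina psik rhok0 etak etarho Xs fins psis y0.
rewrite -/(x k) -/(x k.+1) -/(phi (x k)) -/(phi _) -/(phi _) -/(target k) -/(delta k).
set xh := st_xhat (st k); set gap := enorm (x k.+1 - xh).
have xz : x k.+1 = (1 - tau k) *: x k + tau k *: z k.+1.
  have /(congr1 (fun v => (k%:R + 1)^-1 *: v)) := x_rec kK.
  have kp : k%:R + 1 != 0 :> R by rewrite gt_eqF // addr_gt0 // ltr0n.
  rewrite scalerA mulVf // scale1r => ->.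
  rewrite tauE // scalerDr !scalerA; congr (_ *: _ + _ *: _).
    by field.
  by rewrite mulrC.
have taun : `|tau k| = tau k by rewrite ger0_norm //; case/andP: tau01.
(* The points compared here and in the next two identities share the component [(1 - tau k) x_k]; it
   cancels and leaves a factor [tau k]. *)
have e1 : enorm (target k - xh) ^+ 2 = tau k ^+ 2 * enorm (z k - xs) ^+ 2.
  rewrite -exprMn -[X in X * _]taun -enormZ enormB /xh xhat_z //.
  by rewrite /target [_ *: x k + _]addrC addrKA scalerBr.
have e2 : enorm (target k - x k.+1) ^+ 2 = tau k ^+ 2 * enorm (z k.+1 - xs) ^+ 2.
  rewrite -exprMn -[X in X * _]taun -enormZ enormB {1}xz.
  by rewrite /target [_ *: x k + _]addrC addrKA scalerBr.
have e3 : gap ^+ 2 = tau k ^+ 2 * enorm (z k.+1 - z k) ^+ 2.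
  rewrite -exprMn -[X in X * _]taun -enormZ /gap /xh xhat_z // {1}xz.
  by rewrite [_ *: x k + _]addrC addrKA scalerBr.
rewrite e1 e2.
(* [target k - xh] is known before sample [k] is drawn; the rest depends on the sample and is
   bounded by [|delta| gap]. *)
have -> : dot (delta k) (target k - x k.+1) =
    dot (delta k) (target k - xh) + dot (delta k) (xh - x k.+1).
  by rewrite -dotDr addrA subrK.
have dgap : dot (delta k) (xh - x k.+1) <= enorm (delta k) * gap.
  by rewrite /gap enormB cauchy_schwarz.
have gap0 : 0 <= gap by exact: enorm_ge0.
have gap2 : gap <= 2 * D by apply: enormB_le_half_diam => //; exact: Xxh.
(* The excess of [|y|] over [B] is not covered by the curvature; [gap <= 2 D] turns its quadratic
   cost into a linear one. *)
have yB : (enorm y - B) * enorm Lg / 2 * gap ^+ 2 <=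
    enorm Lg * D * Num.max (enorm y - B) 0 * gap.
  set mx := Num.max _ _.
  have mx1 : enorm y - B <= mx by rewrite le_max lexx.
  have mx0 : 0 <= mx by rewrite le_max lexx orbT.
  have Lg_ge0 := enorm_ge0 Lg.
  have s1 : (enorm y - B) * (enorm Lg * gap ^+ 2) <= mx * (enorm Lg * gap ^+ 2).
    by rewrite ler_wpM2r // mulr_ge0 ?sqr_ge0.
  have s2 : (mx * enorm Lg * gap) * gap <= (mx * enorm Lg * gap) * (2 * D).
    by rewrite ler_wpM2l // !mulr_ge0.
  lra.
have hgap := ler_wpM2r gap0 hh.
have := @quadratic_noise_bound (h + enorm (delta k)) L' gap L'0.
have e3' : Lk / 4 * gap ^+ 2 = Lk / 4 * (tau k ^+ 2 * enorm (z k.+1 - z k) ^+ 2).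
  by rewrite e3.
move: e3' hgap yB dgap; rewrite {1 2}/L'.
set dd := dot _ (target k - xh).
set q1 := (_ / (2 * eta k)); set q2 := (_ ^+ 2 / L').
lra.
Qed.

(** With [w k = k (k + 1)], [w k (1 - tau k) = w k.-1], while [Lk / 2 tau^2] becomes
    [2 Lk k / (k + 1)]. The leading constant is [26 = 2 * 13/4 * 2^2], as the averages are within
    [2 D] of [xs]. *)
Lemma run_bound (y : 'cV[R]_m) (h : R) : 0 <= Lk ->
  (forall i, 0 <= y i 0) ->
  Hf + enorm y * enorm Hg + enorm Lg * D * Num.max (enorm y - B) 0 <= h ->
  (K%:R - 1) * K%:R * (phi (x K) - phi xs + dot y (st_V (st K))) <=
    26 * D ^+ 2 * Lk + K%:R / rho1 * enorm (st_ytilde (st 1%N) - y) ^+ 2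
    + \sum_(1 <= k < K) k%:R * (k%:R + 1) *
        ((h + enorm (delta k)) ^+ 2 / L'
         + dot (delta k) (target k - st_xhat (st k))).
Proof.
move=> Lk0 y0 hh.
have K0 : (0 : R) < K%:R by rewrite ltr0n (leq_trans _ K2).
pose Q k := phi (x k) - phi xs + dot y (st_V (st k)).
pose w k : R := k%:R * (k%:R + 1).
(* This is [w k / (2 eta k)]; it decreases, and [c 1 = K / rho1]. *)
pose c k : R := K%:R / (2 * rho1) * (1 + k%:R^-1).
pose a k := k%:R / (k%:R + 1) * (enorm (z k - xs) ^+ 2 - enorm (z k.+1 - xs) ^+ 2
  - enorm (z k.+1 - z k) ^+ 2 / 2).
pose b k := enorm (st_ytilde (st k) - y) ^+ 2.
pose N k := (h + enorm (delta k)) ^+ 2 / L' + dot (delta k) (target k - st_xhat (st k)).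
have step k : (0 < k < K)%N ->
    w k * Q k.+1 <= w k.-1 * Q k + (2 * Lk * a k + c k * (b k - b k.+1) + w k * N k).
  move=> kK; have /andP[k0 kK1] := kK.
  have kr : (0 : R) < k%:R by rewrite ltr0n.
  have w0 : 0 <= w k by rewrite mulr_ge0 // addr_ge0.
  have := ler_wpM2l w0 (run_step_bound kK y0 hh).
  rewrite -/(Q k) -/(Q k.+1) -/(N k) -/(b k) -/(b k.+1).
  move=> H; apply: (le_trans H).
  rewrite le_eqVlt; apply/orP; left; apply/eqP.
  rewrite /w /c /a tauE ?k0 ?(ltnW kK1) // etaE //.
  have -> : k.-1%:R = k%:R - 1 :> R by rewrite -{2}(prednK k0) -natr1 addrK.
  set zz := (_ - _ - _); set t : R := k%:R.
  field.
  by rewrite !gt_eqF // addr_gt0.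
have := weighted_telescope K2 (mul0r _) step.
rewrite !big_split /= -mulr_sumr -/(Q K).
have -> : w K.-1 = (K%:R - 1) * K%:R.
  by rewrite /w -{3 4}(prednK (ltnW K2)) -natr1 addrK.
have Krho : 0 <= K%:R / (2 * rho1) by rewrite divr_ge0 ?(ltW K0) // mulr_ge0 ?(ltW rho10).
have c0 k : 0 <= c k by rewrite mulr_ge0 // addr_ge0 // invr_ge0.
have cd k : (0 < k)%N -> (k.+1 < K)%N -> c k.+1 <= c k.
  move=> k0 _; rewrite ler_wpM2l // lerD2l.
  by rewrite lef_pV2 ?posrE ?ltr0n // ler_nat.
have hb := @nonincreasing_weight_sum R c b K K2 (fun k _ => c0 k) cd (fun k => sqr_ge0 _).
have c1 : c 1%N = K%:R / rho1 by rewrite /c invr1; field; rewrite gt_eqF.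
rewrite c1 in hb.
have xD k : (0 < k <= K)%N -> enorm (x k - xs) ^+ 2 <= (2 * D) ^+ 2.
  move=> kK; have [Xk _ _] := run_invariants kK.
  have xk : enorm (x k - xs) <= 2 * D by exact: enormB_le_half_diam.
  by rewrite ler_pXn2r // nnegrE ?(le_trans (enorm_ge0 _) xk) // enorm_ge0.
have ha := @momentum_sum R n x z xs _ K (ltnW K2) (erefl _) x_rec xD.
have := ler_wpM2l (mulr_ge0 (ler0n R 2) Lk0) ha.
rewrite -/(\sum_(1 <= k < K) a k) => ha2 H.
apply: (le_trans H); apply: lerD => //; apply: lerD => //.
apply: (le_trans ha2); rewrite exprMn; lra.
Qed.

End DeterministicRun.

(** * Conditional means on product spaces *)

Lemma normr_le_1sqr (R : realType) (a : R) : `|a| <= 1 + a ^+ 2.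
Proof.
rewrite -(real_normK (num_real a)); have := sqr_ge0 (`|a| - 1); nra.
Qed.

Section ConditionalMean.
Context d1 d2 {T : measurableType d1} {S : measurableType d2} {R : realType}.
Context (mu : probability T R) (nu : probability S R) {n : nat}.
Context (psi : 'I_n -> T * S -> R) (mean : 'I_n -> T -> R) (s : R).
Context (mpsi : forall i, measurable_fun setT (psi i)).
Context (meanE : forall i t, (\int[nu]_u (psi i (t, u))%:E = (mean i t)%:E)%E).
Context (var_le : forall t,
  (\int[nu]_u (\sum_i (psi i (t, u) - mean i t) ^+ 2)%:E <= s%:E)%E).

(** The integral is a difference of two nonnegative extended reals, and such a difference is finite
    only if both are. *)
Lemma fin_num_integral_integrable d (U : measurableType d)
    (m : {measure set U -> \bar R}) (h : U -> \bar R) :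
  measurable_fun setT h -> (\int[m]_x h x)%E \is a fin_num ->
  m.-integrable setT h.
Proof.
move=> mh; rewrite integralE => hfin; apply/integrableP; split=> //.
have -> : (fun x => `|h x|)%E = (h^\+ \+ h^\-)%E by rewrite -fune_abse.
rewrite ge0_integralD //; [|exact: measurable_funepos|exact: measurable_funeneg].
have p0 : (0 <= \int[m]_x h^\+ x)%E by apply: integral_ge0.
have n0 : (0 <= \int[m]_x h^\- x)%E by apply: integral_ge0.
by case: (\int[m]_x h^\+ x)%E (\int[m]_x h^\- x)%E hfin p0 n0 => [a||] [b||] //= *;
  rewrite -EFinD ltry.
Qed.

Lemma measurable_partial_integral (h : T * S -> \bar R) :
  measurable_fun setT h -> (forall z, 0 <= h z)%E ->
  measurable_fun setT (fun t => \int[nu]_u h (t, u))%E.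
Proof. by move=> mh h0; exact: (measurable_fun_fubini_tonelli_F (m2 := nu) h mh h0). Qed.

Lemma measurable_psi2 i t : measurable_fun setT (fun u => psi i (t, u)).
Proof. exact: measurable_fun_pair2. Qed.

(** The selection of subgradients is not given as measurable; being a mean of jointly measurable
    values, it is a difference of two partial integrals to which Tonelli applies. *)
Lemma measurable_conditional_mean i : measurable_fun setT (mean i).
Proof.
apply/measurable_EFinP.
have -> : EFin \o mean i =
    (fun t => \int[nu]_u (EFin \o psi i)^\+ (t, u)
              - \int[nu]_u (EFin \o psi i)^\- (t, u))%E.
  apply/funext => t /=; rewrite -meanE integralE; congr (_ - _)%E;
  by apply: eq_integral => u _; rewrite ?funeposE ?funenegE.
apply: emeasurable_funB.
  apply: measurable_partial_integral => //.
  by apply: measurable_funepos; exact/measurable_EFinP.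
apply: measurable_partial_integral => //.
by apply: measurable_funeneg; exact/measurable_EFinP.
Qed.

Let eps i (z : T * S) := psi i z - mean i z.1.

Let meps i : measurable_fun setT (eps i).
Proof.
apply: measurable_funB => //.
by apply: measurableT_comp; [exact: measurable_conditional_mean|exact: measurable_fst].
Qed.

Let meps2 : measurable_fun setT (fun z => \sum_i eps i z ^+ 2).
Proof. by apply: measurable_sum => i; apply: measurable_funX. Qed.

Lemma conditional_variance_le :
  (\int[mu \x nu]_z (\sum_i (psi i z - mean i z.1) ^+ 2)%:E <= s%:E)%E.
Proof.
rewrite (fubini_tonelli1 (fun z => (\sum_i eps i z ^+ 2)%:E)); first last.
- by move=> z; rewrite lee_fin sumr_ge0 // => i _; exact: sqr_ge0.
- exact/measurable_EFinP.
apply: (@le_trans _ _ (\int[mu]_t s%:E)%E); last first.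
  by rewrite integral_cst // [X in (_ * X)%E]probability_setT mule1.
apply: ge0_le_integral => //.
- move=> t _; apply: integral_ge0 => u _.
  by rewrite lee_fin sumr_ge0 // => i _; exact: sqr_ge0.
- apply: (@measurable_partial_integral (fun z => (\sum_i eps i z ^+ 2)%:E)).
    exact/measurable_EFinP.
  by move=> z; rewrite lee_fin sumr_ge0 // => i _; exact: sqr_ge0.
- by move=> t _; exact: var_le.
Qed.

(** The product is dominated by [b (1 + sum eps^2)], integrable by the variance bound. Fubini then
    integrates the second coordinate first, where [c] is constant and the centered value has mean
    0. *)
Lemma conditional_mean0 i (c : T -> R) (b : R) :
  measurable_fun setT c -> (forall t, `|c t| <= b) ->
  (mu \x nu)%E.-integrable setT (fun z => ((psi i z - mean i z.1) * c z.1)%:E) /\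
  (\int[mu \x nu]_z ((psi i z - mean i z.1) * c z.1)%:E = 0)%E.
Proof.
move=> mc cb.
have mG : measurable_fun setT (fun z => (eps i z * c z.1)%:E).
  apply/measurable_EFinP; apply: measurable_funM => //.
  by apply: measurableT_comp => //; exact: measurable_fst.
have b0 (t : T) : 0 <= b by exact: le_trans (normr_ge0 (c t)) (cb t).
have intG : (mu \x nu)%E.-integrable setT (fun z => (eps i z * c z.1)%:E).
  apply: (@le_integrable _ _ _ _ _ measurableT _
      (fun z => (b * (1 + \sum_j eps j z ^+ 2))%:E)) => //.
    move=> z _; rewrite /= lee_fin.
    have sum0 : 0 <= \sum_j eps j z ^+ 2 by apply: sumr_ge0 => j _; exact: sqr_ge0.
    rewrite [leRHS]ger0_norm ?mulr_ge0 ?addr_ge0 ?(b0 z.1) // normrM mulrC.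
    rewrite ler_pM // (@le_trans _ _ (1 + eps i z ^+ 2)) //.
      exact: normr_le_1sqr.
    by rewrite lerD2l (bigD1 i) //= lerDl sumr_ge0 // => j _; exact: sqr_ge0.
  have intE : (mu \x nu)%E.-integrable setT (fun z => (\sum_j eps j z ^+ 2)%:E).
    apply/integrableP; split; first exact/measurable_EFinP.
    apply: le_lt_trans (ltry s); apply: le_trans conditional_variance_le.
    rewrite le_eqVlt; apply/orP; left; apply/eqP; apply: eq_integral => z _.
    by rewrite gee0_abs // lee_fin sumr_ge0 // => j _; exact: sqr_ge0.
  pose munu : probability (T * S)%type R := (mu \x nu)%E.
  have int1 := finite_measure_integrable_cst munu (1 : R) measurableT.
  exact: (integrableZl measurableT b (integrableD measurableT int1 intE)).
split=> //.
rewrite -(integral12_prod_meas1 intG) /fubini_F.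
rewrite -[RHS](integral0 mu setT); apply: eq_integral => t _ /=.
have ipsi : nu.-integrable setT (fun u => (psi i (t, u))%:E).
  apply: fin_num_integral_integrable; last by rewrite meanE.
  by apply/measurable_EFinP; exact: measurable_psi2.
have icst : nu.-integrable setT (fun u => (mean i t)%:E).
  exact: (finite_measure_integrable_cst _ (mean i t) measurableT).
under eq_integral do rewrite /eps /= mulrC EFinM EFinB.
rewrite integralZl //; last exact: integrableB.
have cE : (\int[nu]_x (mean i t)%:E = (mean i t)%:E)%E.
  by rewrite integral_cst // [X in (_ * X)%E]probability_setT mule1.
rewrite integralB // meanE cE.
by rewrite subee // mule0.
Qed.
End ConditionalMean.

(** * Joint laws of independent variables *)

Section ProductLaw.
Context d dT dS {Omega : measurableType d} {T : measurableType dT}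
  {S : measurableType dS} {R : realType} (P : probability Omega R).
Context (h : {mfun Omega >-> T}) (U : {mfun Omega >-> S}).

Lemma measurable_integral_distribution (phi : S -> \bar R) :
  measurable_fun setT phi ->
  (\int[distribution P U]_u phi u = \int[P]_w phi (U w))%E.
Proof.
move=> mphi; rewrite integralE [RHS]integralE; congr (_ - _)%E.
  rewrite ge0_integral_distribution //; last exact: measurable_funepos.
  by apply: eq_integral => w _; rewrite /= !funeposE.
rewrite ge0_integral_distribution //; last exact: measurable_funeneg.
by apply: eq_integral => w _; rewrite /= !funenegE.
Qed.

Context (indep : forall A C, measurable A -> measurable C ->
  (P (h @^-1` A `&` U @^-1` C) = P (h @^-1` A) * P (U @^-1` C))%E).

Let mhU : measurable_fun setT (fun w => (h w, U w)).
Proof. by apply: measurable_fun_pair; exact: measurable_funPT. Qed.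

Let hU : {mfun Omega >-> (T * S)%type} := mfun_Sub (mem_set mhU).

(** Independence is agreement on measurable rectangles, which determines the product measure. *)
Let lawE (A : set (T * S)) : measurable A ->
  (distribution P h \x distribution P U)%E A = distribution P hU A.
Proof.
apply: (@product_measure_unique _ _ _ _ _ (distribution P h) (distribution P U)
  (distribution P hU)) => B C mB mC.
by rewrite /distribution /pushforward /= -indep.
Qed.

Lemma ge0_integral_independent (phi : T * S -> \bar R) :
  measurable_fun setT phi -> (forall z, 0 <= phi z)%E ->
  (\int[P]_w phi (h w, U w) =
   \int[distribution P h \x distribution P U]_z phi z)%E.
Proof.
move=> mphi phi0.
rewrite (eq_measure_integral (distribution P hU)); last by move=> A mA _; exact: lawE.
by rewrite ge0_integral_distribution.
Qed.

Lemma integrable_independent (phi : T * S -> \bar R) :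
  (distribution P h \x distribution P U)%E.-integrable setT phi ->
  P.-integrable setT (fun w => phi (h w, U w)).
Proof.
move=> /integrableP[mphi phioo]; apply/integrableP; split.
  exact: (measurableT_comp mphi mhU).
rewrite (@ge0_integral_independent (fun z => `|phi z|)%E) //.
exact: measurableT_comp.
Qed.

Lemma integral_independent (phi : T * S -> \bar R) :
  measurable_fun setT phi ->
  (\int[P]_w phi (h w, U w) =
   \int[distribution P h \x distribution P U]_z phi z)%E.
Proof.
move=> mphi; rewrite integralE [RHS]integralE.
congr (_ - _)%E.
  rewrite -ge0_integral_independent //; last exact: measurable_funepos.
  by apply: eq_integral => w _; rewrite !funeposE.
rewrite -ge0_integral_independent //; last exact: measurable_funeneg.
by apply: eq_integral => w _; rewrite !funenegE.
Qed.

End ProductLaw.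

(** * Borel structure on column vectors *)

Section BorelVectors.
Context {R : realType} {n : nat}.

Lemma measurable_coord (i : 'I_n) :
  measurable_fun setT (fun v : borel_cV R n => (v : 'cV[R]_n) i 0).
Proof.
apply: (measurability _ (RGenOInfty.measurableE R)) => _ [_ [a ->] <-].
rewrite setTI; apply: sub_sigma_algebra.
apply: (@open_comp _ _ (fun v : 'cV[R]_n => v i 0)); last exact: interval_open.
by move=> v _; exact: coord_continuous.
Qed.

Lemma closed_measurable_cV (X : set 'cV[R]_n) :
  closed X -> measurable (X : set (borel_cV R n)).
Proof.
move=> cX; rewrite -(setCK X); apply: measurableC.
by apply: sub_sigma_algebra; exact: closed_openC.
Qed.

Lemma compact_measurable_cV (X : set 'cV[R]_n) :
  compact X -> measurable (X : set (borel_cV R n)).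
Proof.
by move=> kX; apply: closed_measurable_cV; apply: compact_closed => //; exact: norm_hausdorff.
Qed.
End BorelVectors.

(** * Oracle noise *)

Section OracleNoise.
Context {R : realType} {n m : nat} {d d' : measure_display}.
Context {Omega : measurableType d} {Xi : measurableType d'}.
Context (P : probability Omega R).

(** The noise term involves x_k and hat x_k jointly, so events of the pair are needed. Both
    coordinates are measurable for the sigma-algebra generated by the history, hence so is the
    pair. *)
Lemma history_state_pair (Z : nat -> Omega -> state R n m)
    (xi : nat -> Omega -> Xi) k (A : set (borel_cV R n * borel_cV R n)) :
  (0 < k)%N -> measurable A ->
  history Z xi k ((fun w => (st_x (Z k w), st_xhat (Z k w))) @^-1` A).
Proof.
move=> k0 mA; rewrite /history; set H := (X in <<s X >>).
pose T := g_sigma_algebraType H.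
have mx : measurable_fun (setT : set T)
    (fun w : T => (st_x (Z k w) : borel_cV R n)).
  move=> _ C mC; apply: sub_sigma_algebra; left; exists k => /=.
    by rewrite k0 leqnn.
  by do 5 left; exists C.
have mxh : measurable_fun (setT : set T)
    (fun w : T => (st_xhat (Z k w) : borel_cV R n)).
  move=> _ C mC; apply: sub_sigma_algebra; left; exists k => /=.
    by rewrite k0 leqnn.
  by do 4 left; right; exists C.
have := measurable_fun_pair mx mxh measurableT mA.
by rewrite setTI.
Qed.

Context (X : set 'cV[R]_n) (kX : compact X).
Context (F : 'cV[R]_n -> Xi -> 'cV[R]_n) (f' : 'cV[R]_n -> 'cV[R]_n) (sigma : R).
Context (mF : measurable_oracle X F).
Context (U : {RV P >-> Xi}) (ubv : unbiased_bounded_variance P X F f' sigma U).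
Context (x xh : Omega -> 'cV[R]_n) (Xx : forall w, X (x w)) (Xxh : forall w, X (xh w)).
Context (mx : random_vector x) (mxh : random_vector xh).
Context (indep : forall (A : set (borel_cV R n * borel_cV R n)) C,
  measurable A -> measurable C ->
  (P ((fun w => (x w, xh w)) @^-1` A `&` U @^-1` C) =
   P ((fun w => (x w, xh w)) @^-1` A) * P (U @^-1` C))%E).

Let T := (borel_cV R n * borel_cV R n)%type.

Let mpair : measurable_fun setT (fun w => (x w, xh w) : T).
Proof. exact: measurable_fun_pair. Qed.

Let h : {mfun Omega >-> T} := mfun_Sub (mem_set mpair).
Let mu : probability T R := distribution P h.
Let nu : probability Xi R := distribution P U.

(** The oracle is controlled only for query points in [X]; extending it and its mean by 0 gives
    functions on the whole product. In [z.1] the first component is x_k and the second the query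
    point hat x_k. *)
Let psi (i : 'I_n) (z : T * Xi) : R :=
  ((fun p : borel_cV R n * Xi => F p.1 p.2 i 0 : R) \_
     ((X : set (borel_cV R n)) `*` [set: Xi])) (z.1.2, z.2).

Let mean (i : 'I_n) (t : T) : R := if t.2 \in X then f' t.2 i 0 else 0.

Let mX : measurable (X : set (borel_cV R n)).
Proof. exact: compact_measurable_cV. Qed.

Let mFi i : measurable_fun (X `*` setT : set (borel_cV R n * Xi))
  (fun p : borel_cV R n * Xi => F p.1 p.2 i 0).
Proof. exact: (measurableT_comp (measurable_coord i) mF). Qed.

Let mpsi i : measurable_fun setT (psi i).
Proof.
have mr : measurable_fun setT
    ((fun p : borel_cV R n * Xi => F p.1 p.2 i 0 : R) \_
     ((X : set (borel_cV R n)) `*` [set: Xi])).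
  by apply/(measurable_restrictT _ _).1; [exact: measurableX|exact: mFi].
apply: (measurableT_comp mr); apply: measurable_fun_pair; last exact: measurable_snd.
by apply: measurableT_comp; [exact: measurable_snd|exact: measurable_fst].
Qed.

Let psi_in i (t : T) u : X t.2 -> psi i (t, u) = F t.2 u i 0.
Proof. by move=> Xt; rewrite /psi patchE /= mem_set. Qed.

Let psi_out i (t : T) u : ~ X t.2 -> psi i (t, u) = 0.
Proof. by move=> Xt; rewrite /psi patchE /= memNset // => -[]. Qed.

Let mean_in i (t : T) : X t.2 -> mean i t = f' t.2 i 0.
Proof. by move=> Xt; rewrite /mean mem_set. Qed.

Let mean_out i (t : T) : ~ X t.2 -> mean i t = 0.
Proof. by move=> Xt; rewrite /mean memNset. Qed.

Let meanE i t : (\int[nu]_u (psi i (t, u))%:E = (mean i t)%:E)%E.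
Proof.
have [Xt|Xt] := pselect (X t.2); last first.
  rewrite mean_out //; under eq_integral do rewrite psi_out //.
  exact: integral0.
rewrite measurable_integral_distribution; last first.
  by apply/measurable_EFinP; exact: measurable_fun_pair2.
rewrite mean_in //; have [<- _] := ubv Xt.
rewrite unlock; apply: eq_integral => w _; by rewrite psi_in.
Qed.

Let var_le t :
  (\int[nu]_u (\sum_i (psi i (t, u) - mean i t) ^+ 2)%:E <= (sigma ^+ 2)%:E)%E.
Proof.
have [Xt|Xt] := pselect (X t.2); last first.
  under eq_integral.
    move=> u _; rewrite big1 => [|i _]; last by rewrite psi_out // mean_out // subrr expr0n.
    over.
  by rewrite integral0 lee_fin sqr_ge0.
rewrite measurable_integral_distribution; last first.
  apply/measurable_EFinP; apply: measurable_sum => i; apply: measurable_funX.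
  by apply: measurable_funB => //; exact: measurable_fun_pair2.
have [_] := ubv Xt; apply: le_trans.
rewrite [in leRHS]unlock le_eqVlt; apply/orP; left; apply/eqP.
apply: eq_integral => w _ /=; rewrite enorm_sqr; congr (_%:E).
by apply: eq_bigr => i _; rewrite psi_in // mean_in // !mxE expr2.
Qed.

Let noise w := F (xh w) (U w) - f' (xh w).

Let noiseE i w : noise w i 0 = psi i (h w, U w) - mean i (h w).
Proof. by rewrite psi_in ?mean_in //= ?mxE. Qed.

Let noise_sqrE w : enorm (noise w) ^+ 2 =
  \sum_i (psi i (h w, U w) - mean i (h w, U w).1) ^+ 2.
Proof.
by rewrite enorm_sqr; apply: eq_bigr => i _; rewrite noiseE expr2.
Qed.

Let mpsi_mean i : measurable_fun setT (fun z : T * Xi => psi i z - mean i z.1).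
Proof.
apply: measurable_funB => //; apply: measurableT_comp; last exact: measurable_fst.
exact: (measurable_conditional_mean mpsi meanE).
Qed.

Lemma oracle_noise_variance :
  measurable_fun setT (fun w => enorm (noise w) ^+ 2) /\
  (\int[P]_w (enorm (noise w) ^+ 2)%:E <= (sigma ^+ 2)%:E)%E.
Proof.
have ms : measurable_fun setT (fun z : T * Xi =>
    \sum_i (psi i z - mean i z.1) ^+ 2).
  by apply: measurable_sum => i; exact: measurable_funX.
have mhU : measurable_fun setT (fun w => (h w, U w)).
  by apply: measurable_fun_pair; exact: measurable_funPT.
split.
  rewrite (_ : (fun w => _) = (fun z : T * Xi =>
    \sum_i (psi i z - mean i z.1) ^+ 2) \o (fun w => (h w, U w))).
    exact: measurableT_comp.
  by apply/funext => w; rewrite noise_sqrE.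
under eq_integral do rewrite noise_sqrE.
rewrite (@ge0_integral_independent _ _ _ _ _ _ _ P h U indep
  (fun z => (\sum_i (psi i z - mean i z.1) ^+ 2)%:E)).
- exact: (conditional_variance_le mu mpsi meanE var_le).
- exact/measurable_EFinP.
- by move=> z; rewrite lee_fin sumr_ge0 // => i _; exact: sqr_ge0.
Qed.

Lemma oracle_noise_mean0 (a : R) (u : 'cV[R]_n) :
  let inner w := dot (noise w) ((1 - a) *: x w + a *: u - xh w) in
  [/\ measurable_fun setT inner, P.-integrable setT (EFin \o inner) &
      (\int[P]_w (inner w)%:E = 0)%E].
Proof.
move=> inner.
(* Cutting the direction off outside [X * X] makes it bounded and changes nothing along the run. *)
pose c i : T -> R := (fun t : T => ((1 - a) *: (t.1 : 'cV[R]_n) + a *: u - t.2) i 0 : R) \_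
  ((X : set (borel_cV R n)) `*` (X : set (borel_cV R n))).
have mc i : measurable_fun setT (c i).
  apply/(measurable_restrictT _ _).1; first exact: measurableX.
  apply: measurable_funTS.
  rewrite (_ : (fun _ => _) = fun t : T =>
    (1 - a) * (t.1 : 'cV[R]_n) i 0 + a * u i 0 - (t.2 : 'cV[R]_n) i 0); last first.
    by apply/funext => t; rewrite !mxE.
  apply: measurable_funB; last exact: (measurableT_comp (measurable_coord i) measurable_snd).
  apply: measurable_funD => //; apply: measurable_funM => //.
  exact: (measurableT_comp (measurable_coord i) measurable_fst).
have [b b0 hb] := compact_enorm_bounded kX.
have cb i t : `|c i t| <= `|1 - a| * b + `|a| * enorm u + b.
  rewrite /c patchE; case: ifPn => [|_]; last by rewrite normr0 !addr_ge0 ?mulr_ge0 ?enorm_ge0.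
  move=> /set_mem [/= Xt1 Xt2]; rewrite !mxE.
  apply: le_trans (ler_normB _ _) _; apply: lerD; last first.
    by apply: le_trans (coord_le_enorm _ _) (hb _ Xt2).
  apply: le_trans (ler_normD _ _) _; rewrite !normrM.
  apply: lerD; apply: ler_wpM2l => //; last exact: coord_le_enorm.
  by apply: le_trans (coord_le_enorm _ _) (hb _ Xt1).
have cE i w : c i (h w) = ((1 - a) *: x w + a *: u - xh w) i 0.
  by rewrite /c patchE mem_set; last by split; [exact: Xx|exact: Xxh].
have innerE w : (inner w)%:E = (\sum_i ((psi i (h w, U w) - mean i (h w, U w).1)
    * c i (h w, U w).1)%:E)%E.
  rewrite /inner /dot sumEFin; congr (_%:E).
  by apply: eq_bigr => i _; rewrite noiseE cE.
have cm0 i := conditional_mean0 mu mpsi meanE var_le i (mc i) (cb i).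
have intw (i : 'I_n) : P.-integrable setT (fun w =>
    ((psi i (h w, U w) - mean i (h w, U w).1) * c i (h w, U w).1)%:E).
  have [iG _] := cm0 i.
  exact: (@integrable_independent _ _ _ _ _ _ _ P h U indep
    (fun z => ((psi i z - mean i z.1) * c i z.1)%:E) iG).
have intI : P.-integrable setT (EFin \o inner).
  rewrite (_ : EFin \o inner = fun w => (\sum_i ((psi i (h w, U w)
    - mean i (h w, U w).1) * c i (h w, U w).1)%:E)%E); last exact/funext.
  by apply: integrable_sum => // i _; exact: intw.
split=> //; first by apply/measurable_EFinP; exact: measurable_int intI.
under eq_integral do rewrite innerE.
rewrite integral_sum // big1 // => i _.
have [iG <-] := cm0 i.
apply: (@integral_independent _ _ _ _ _ _ _ P h U indep
  (fun z => ((psi i z - mean i z.1) * c i z.1)%:E)).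
exact: measurable_int iG.
Qed.

End OracleNoise.

(** * Integral estimates *)

Section IntegralBounds.
Local Open Scope ereal_scope.
Context d {T : measurableType d} {R : realType} (mu : {measure set T -> \bar R}).

(** For nonnegative functions the integral is a supremum over simple functions below, hence monotone
    without measurability. *)
Lemma ge0_le_integral_nonmeasurable (f h : T -> \bar R) :
  (forall x, 0 <= f x) -> (forall x, f x <= h x) ->
  \int[mu]_x f x <= \int[mu]_x h x.
Proof.
move=> f0 fh; have h0 x : 0 <= h x := le_trans (f0 x) (fh x).
rewrite !ge0_integralTE //; apply: ereal_sup_le => _ [s sf <-].
by exists s => // x; apply: le_trans (fh x); exact: sf.
Qed.

Lemma le_integral_nonmeasurable (f h : T -> \bar R) :
  mu.-integrable setT h -> (forall x, f x <= h x) ->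
  \int[mu]_x f x <= \int[mu]_x h x.
Proof.
move=> ih fh; rewrite (integralE _ _ f) (integralE _ _ h); apply: leeB.
  apply: ge0_le_integral_nonmeasurable => x //.
  by rewrite !funeposE ge_max !le_max fh lexx orbT.
apply: ge0_le_integral_nonmeasurable => x //.
by rewrite !funenegE ge_max !le_max leeN2 fh lexx orbT.
Qed.

(* b need not be measurable: the measurable function (v - h)^+ / c is
   below it. *)
Lemma integral_le_add_nonmeasurable (v h b : T -> R) (c : R) : (0 < c)%R ->
  measurable_fun setT v -> mu.-integrable setT (EFin \o h) ->
  (forall x, 0 <= v x)%R -> (forall x, 0 <= b x)%R ->
  (forall x, v x <= h x + c * b x)%R ->
  \int[mu]_x (v x)%:E <= \int[mu]_x (h x)%:E + \int[mu]_x (b x)%:E * c%:E.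
Proof.
move=> c0 mv ih v0 b0 vhb.
have mh : measurable_fun setT h by apply/measurable_EFinP; exact: measurable_int ih.
pose e x := Num.max ((v x - h x) / c)%R 0%R.
have me : measurable_fun setT e.
  apply: measurable_maxr => //; apply: measurable_funM => //.
  exact: measurable_funB.
have e0 x : (0 <= e x)%R by rewrite le_max lexx orbT.
have eb : \int[mu]_x (e x)%:E <= \int[mu]_x (b x)%:E.
  apply: ge0_le_integral_nonmeasurable => x; rewrite lee_fin //.
  by rewrite ge_max b0 andbT ler_pdivrMr // lerBlDl mulrC vhb.
(* If the integral of [b] is infinite, so is the right side, because that of [h] is finite. *)
have [boo|] := eqVneq (\int[mu]_x (b x)%:E) +oo.
  have /integrable_fin_num : mu.-integrable setT (EFin \o h) := ih.
  rewrite fin_numE => /(_ measurableT) /andP[hN _].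
  by rewrite boo gt0_mulye ?lte_fin // addey ?leey.
move=> bfin.
have ie : mu.-integrable setT (EFin \o e).
  apply/integrableP; split; first exact/measurable_EFinP.
  apply: le_lt_trans (_ : \int[mu]_x (b x)%:E < +oo); last by rewrite ltey.
  rewrite (eq_integral (EFin \o e)) // => x _.
  by rewrite /= ger0_norm.
have ihe : mu.-integrable setT (EFin \o (fun x => h x + c * e x)%R).
  have := integrableD measurableT ih (integrableZl measurableT c ie).
  by apply: eq_integrable.
apply: (@le_trans _ _ (\int[mu]_x (h x + c * e x)%:E)).
  apply: le_integral_nonmeasurable ihe _ => x; rewrite /= lee_fin.
  rewrite /e -lerBlDl -ler_pdivrMl // mulrC le_max.
  by rewrite lexx.
have -> : \int[mu]_x (h x + c * e x)%:E =
    \int[mu]_x (h x)%:E + c%:E * \int[mu]_x (e x)%:E.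
  under eq_integral do rewrite EFinD EFinM.
  rewrite integralD //; last exact: (integrableZl measurableT c ie).
  by rewrite integralZl.
by rewrite leeD2l // muleC lee_wpmul2r // lee_fin ltW.
Qed.

End IntegralBounds.

(** * Expectation of the accumulated noise *)

Section NoiseSum.
Context d {Omega : measurableType d} {R : realType} (P : probability Omega R).

Lemma expected_noise_sum_le (K : nat) (W1 W2 : nat -> Omega -> R) (wt : nat -> R)
    (C A q r s : R) :
  (forall k, (0 < k < K)%N -> P.-integrable setT (EFin \o W1 k) /\
     (\int[P]_w (W1 k w)%:E = 0)%E) ->
  (forall k, (0 < k < K)%N -> measurable_fun setT (W2 k) /\
     (\int[P]_w (W2 k w)%:E <= s%:E)%E) ->
  (forall k w, 0 <= W2 k w) -> (forall k, 0 <= wt k) -> 0 <= q -> 0 < r ->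
  let N w := C + \sum_(1 <= k < K) wt k * ((A + q * W2 k w) / r + W1 k w) in
  P.-integrable setT (EFin \o N) /\
  (\int[P]_w (N w)%:E <= (C + (\sum_(1 <= k < K) wt k) * ((A + q * s) / r))%:E)%E.
Proof.
move=> hW1 hW2 W20 wt0 q0 r0.
have cst_int c : P.-integrable setT (EFin \o cst c) /\ (\int[P]_w c%:E = c%:E)%E.
  split; first exact: (finite_measure_integrable_cst P c measurableT).
  by rewrite integral_cst // [X in (_ * X)%E]probability_setT mule1.
have add_int (h1 h2 : Omega -> R) c1 c2 :
    P.-integrable setT (EFin \o h1) /\ (\int[P]_w (h1 w)%:E <= c1%:E)%E ->
    P.-integrable setT (EFin \o h2) /\ (\int[P]_w (h2 w)%:E <= c2%:E)%E ->
    P.-integrable setT (EFin \o (fun w => h1 w + h2 w)) /\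
    (\int[P]_w (h1 w + h2 w)%:E <= (c1 + c2)%:E)%E.
  move=> [i1 l1] [i2 l2]; split; first exact: (integrableD measurableT i1 i2).
  under eq_integral do rewrite EFinD.
  by rewrite integralD // EFinD leeD.
have scale_int (h : Omega -> R) c a : 0 <= a ->
    P.-integrable setT (EFin \o h) /\ (\int[P]_w (h w)%:E <= c%:E)%E ->
    P.-integrable setT (EFin \o (fun w => a * h w)) /\
    (\int[P]_w (a * h w)%:E <= (a * c)%:E)%E.
  move=> a0 [i l]; split; first exact: (integrableZl measurableT a i).
  under eq_integral do rewrite EFinM.
  by rewrite integralZl // EFinM lee_wpmul2l.
have cst_le c : P.-integrable setT (EFin \o cst c) /\ (\int[P]_w c%:E <= c%:E)%E.
  by have [i ->] := cst_int c.
apply: (add_int); first exact: cst_le.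
have H J : (J <= K)%N ->
    P.-integrable setT (EFin \o (fun w =>
      \sum_(1 <= k < J) wt k * ((A + q * W2 k w) / r + W1 k w))) /\
    (\int[P]_w (\sum_(1 <= k < J) wt k * ((A + q * W2 k w) / r + W1 k w))%:E
      <= ((\sum_(1 <= k < J) wt k) * ((A + q * s) / r))%:E)%E.
  (* The sum starts at 1, so it is empty both for [J = 0] and for [J = 1]. *)
  elim: J => [_|[_ _|J IH JK]].
  - under eq_fun do rewrite big_geq //.
    under eq_integral do rewrite big_geq //.
    by rewrite big_geq // mul0r; exact: cst_le.
  - under eq_fun do rewrite big_geq //.
    under eq_integral do rewrite big_geq //.
    by rewrite big_geq // mul0r; exact: cst_le.
  under eq_fun do rewrite big_nat_recr //=.
  under eq_integral do rewrite big_nat_recr //=.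
  rewrite big_nat_recr //= mulrDl; apply: (add_int); first exact: IH (ltnW JK).
  apply: (scale_int) => //.
  have [i1 e1] := hW1 J.+1 JK; have [m2 l2] := hW2 J.+1 JK.
  rewrite -[(A + q * s) / r]addr0; apply: (add_int); last by rewrite e1.
  rewrite mulrC; under eq_fun do rewrite mulrC; under eq_integral do rewrite mulrC.
  apply: (scale_int); first by rewrite invr_ge0 ltW.
  apply: (add_int); first exact: cst_le.
  apply: (scale_int) => //; split=> //.
  apply/integrableP; split; first exact/measurable_EFinP.
  apply: le_lt_trans (ltry s); apply: le_trans l2.
  rewrite le_eqVlt; apply/orP; left; apply/eqP; apply: eq_integral => w _.
  by rewrite /= ger0_norm.
exact: H.
Qed.

Lemma sum_weights (K : nat) : (0 < K)%N ->
  \sum_(1 <= k < K) (k%:R * (k%:R + 1) : R) = (K%:R - 1) * K%:R * (K%:R + 1) / 3.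
Proof.
case: K => // K _; elim: K => [|K IH]; first by rewrite big_geq // subrr !mul0r.
rewrite big_nat_recr //= IH -[K.+2%:R]natr1; by field.
Qed.

End NoiseSum.

(** * Saddle points and constants *)

Section SaddlePoint.
Context {R : realType} {n m : nat} (X : set 'cV[R]_n) (f : 'cV[R]_n -> R).
Context (chi0 : 'cV[R]_n -> \bar R) (g chi : 'cV[R]_n -> 'cV[R]_m).
Context (xs : 'cV[R]_n) (ys : 'cV[R]_m).
Context (sp : saddle_point X f chi0 g chi xs ys).

Let phi x := f x + fine (chi0 x).

Lemma psi0_fin x : chi0 x \is a fin_num -> psi0 f chi0 x = (phi x)%:E.
Proof. by move=> xfin; rewrite /psi0 -(fineK xfin) -EFinD. Qed.

Lemma saddle_fin : chi0 xs \is a fin_num.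
Proof. by case: sp => _ _ + _; rewrite /lagrangian /psi0; case: (chi0 xs). Qed.

Let dot_le (y : 'cV[R]_m) : (forall i, 0 <= y i 0) -> dot y (psi g chi xs) <= dot ys (psi g chi xs).
Proof.
case: sp => Xs _ _ sad y0; have [+ _] := sad xs y Xs y0.
by rewrite /lagrangian psi0_fin ?saddle_fin // -!EFinD lee_fin lerD2l.
Qed.

(** Maximality of [ys] is tested against [ys + e_i]. *)
Lemma saddle_feasible i : psi g chi xs i 0 <= 0.
Proof.
have ys0 : forall i, 0 <= ys i 0 by case: sp.
have := @dot_le (ys + delta_mx i 0); rewrite dotDl gerDl => h.
have -> : psi g chi xs i 0 = dot (delta_mx i 0) (psi g chi xs).
  rewrite /dot (bigD1 i) //= big1 => [|j ji].
    by rewrite addr0 [delta_mx _ _ _ _]mxE !eqxx mul1r.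
  by rewrite [delta_mx _ _ _ _]mxE (negbTE ji) mul0r.
by apply: h => j; rewrite !mxE addr_ge0 // ler0n.
Qed.

Lemma saddle_complementary : dot ys (psi g chi xs) = 0.
Proof.
have ys0 : forall i, 0 <= ys i 0 by case: sp.
apply/eqP; rewrite eq_le; apply/andP; split.
  rewrite -(dot0r ys); apply: dot_le_nneg => // i.
  by rewrite [leRHS]mxE; exact: saddle_feasible.
by rewrite -(dot0l (psi g chi xs)); apply: dot_le => i; rewrite mxE.
Qed.

Lemma saddle_lower_bound x : X x -> chi0 x \is a fin_num ->
  phi xs <= phi x + dot ys (psi g chi x).
Proof.
case: sp => Xs ys0 _ sad Xx xfin; have [_] := sad x ys Xx ys0.
rewrite /lagrangian !psi0_fin ?saddle_fin // -!EFinD lee_fin.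
by rewrite saddle_complementary addr0.
Qed.

Lemma pos_part_ge0 (u : 'cV[R]_m) i : 0 <= pos_part u i 0.
Proof. by rewrite mxE le_max lexx orbT. Qed.

Lemma pos_part_ge (u : 'cV[R]_m) i : u i 0 <= pos_part u i 0.
Proof. by rewrite mxE le_max lexx. Qed.

Lemma dot_pos_part (u : 'cV[R]_m) : dot (pos_part u) u = enorm (pos_part u) ^+ 2.
Proof.
rewrite enorm_sqr; apply: eq_bigr => i _; rewrite mxE.
by case: (leP 0 (u i 0)) => // _; rewrite !mul0r.
Qed.

(** The saddle point limits the decrease of the objective to [|ys| |v|], while [yhat] contributes
    [(|ys| + 1) |v|]; the extra 1 leaves [|v|]. For [v = 0] the inverse of 0 is 0, so [yhat = 0]. *)
Lemma violation_le_gap x (V : 'cV[R]_m) :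
  let v := pos_part (psi g chi x) in
  let yhat := (enorm ys + 1) *: ((enorm v)^-1 *: v) in
  X x -> chi0 x \is a fin_num -> (forall i, psi g chi x i 0 <= V i 0) ->
  [/\ forall i, 0 <= yhat i 0, enorm yhat <= enorm ys + 1 &
      enorm v <= phi x - phi xs + dot yhat V].
Proof.
move=> v yhat Xx xfin xV.
have ys0 : forall i, 0 <= ys i 0 by case: sp.
have ysn : 0 <= enorm ys + 1 by rewrite addr_ge0 ?enorm_ge0.
have v0 : forall i, 0 <= v i 0 by exact: pos_part_ge0.
have yhat0 : forall i, 0 <= yhat i 0.
  move=> i; rewrite [leRHS]mxE [X in _ * X]mxE.
  by rewrite mulr_ge0 // mulr_ge0 ?invr_ge0 ?enorm_ge0 ?v0.
split=> //.
  rewrite !enormZ (ger0_norm ysn) ger0_norm ?invr_ge0 ?enorm_ge0 //.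
  have [->|vn0] := eqVneq (enorm v) 0; first by rewrite mulr0 mulr0.
  by rewrite mulVf // mulr1.
have h1 := saddle_lower_bound Xx xfin.
have h2 : dot ys (psi g chi x) <= enorm ys * enorm v.
  apply: le_trans (cauchy_schwarz _ _); apply: dot_le_nneg => // i.
  exact: pos_part_ge.
have h3 : dot yhat (psi g chi x) <= dot yhat V by apply: dot_le_nneg.
have h4 : dot yhat (psi g chi x) = (enorm ys + 1) * enorm v.
  rewrite !dotZl dot_pos_part -/v; congr (_ * _).
  have [->|vn0] := eqVneq (enorm v) 0; first by rewrite expr0n mulr0.
  by rewrite expr2 mulKf.
lra.
Qed.

End SaddlePoint.
Arguments saddle_fin {R n m X f chi0 g chi xs ys}.

Section Measurability.
Context {R : realType} {m : nat} {d : measure_display} {Omega : measurableType d}.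

Lemma measurable_enorm_pos_part (u : Omega -> 'cV[R]_m) :
  (forall i, measurable_fun setT (fun w => u w i 0)) ->
  measurable_fun setT (fun w => enorm (pos_part (u w))).
Proof.
move=> mu; rewrite /enorm.
have msq : measurable_fun setT (@Num.sqrt R).
  exact: (continuous_measurable_fun (@sqrt_continuous R)).
apply: (measurableT_comp msq); apply: measurable_sum => i.
apply: measurable_funX; under eq_fun do rewrite mxE.
exact: measurable_maxr.
Qed.

Lemma expectationE (P : probability Omega R) (Y : Omega -> R) :
  ('E_P[Y] = \int[P]_w (Y w)%:E)%E.
Proof. by rewrite unlock. Qed.

End Measurability.

(** * Arithmetic of the constants *)

Section FinalConstants.
Context {R : realType}.
Context (D Lsum0 rho1 M S K : R).
Context (D0 : 0 < D) (rho10 : 0 < rho1) (M0 : 0 < M) (S0 : 0 <= S) (K2 : 2 <= K).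

Let K0 : 0 < K. Proof. exact: lt_le_trans K2. Qed.
Let K1 : 0 < K - 1. Proof. by move: K2; lra. Qed.

Let L' := 2 * (rho1 * K * M ^+ 2) + K * S / (120 * D).
Let Lk := 2 * (Lsum0 + rho1 * K * M ^+ 2) + K * S / (120 * D).

Lemma residual_curvature_gt0 : 0 < L'.
Proof.
have h1 : 0 < rho1 * K * M ^+ 2 by rewrite !mulr_gt0 ?exprn_gt0.
have h2 : 0 <= K * S / (120 * D) by rewrite divr_ge0 ?mulr_ge0 ?(ltW K0) ?(ltW D0).
by rewrite /L'; lra.
Qed.

Lemma leading_term_eq : 26 * D ^+ 2 * Lk / ((K - 1) * K) =
  52 * D ^+ 2 * (Lsum0 + rho1 * K * M ^+ 2) / ((K - 1) * K) + 13 * D * S / (60 * (K - 1)).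
Proof. by rewrite /Lk; field; rewrite !gt_eqF. Qed.

Lemma noise_denominator_eq : K * (240 * D * rho1 * M ^+ 2 + S) = 120 * D * L'.
Proof. by rewrite /L'; field; rewrite gt_eqF. Qed.

Lemma objective_noise_le E : 0 <= E ->
  (K + 1) / 3 * ((2 * E) / L') <=
  80 * D * (K + 3) * E / (K * (240 * D * rho1 * M ^+ 2 + S)).
Proof.
move=> E0; rewrite noise_denominator_eq.
have L'0 := residual_curvature_gt0.
have -> : 80 * D * (K + 3) * E / (120 * D * L') = (K + 3) / 3 * (2 * E / L').
  by field; rewrite !gt_eqF.
apply: ler_wpM2r; last by lra.
by rewrite divr_ge0 ?mulr_ge0 // ltW.
Qed.

(** The noise exceeds its stated share by at most [(K - 1) / 3 * T / L']. Since
    [L' >= K S / (120 D)] and [S^2 = 120 K T], [T / L' <= D S / K^2], and raising 13/60 to 13/6 pays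
    for the excess. *)
Lemma feasibility_noise_le T : S ^+ 2 = 120 * K * T -> 0 <= T ->
  13 * D * S / (60 * (K - 1)) + (K + 1) / 3 * ((2 * T) / L') <=
  13 * D * S / (6 * (K - 1))
  + 40 * D * (K + 3) * T / (K * (240 * D * rho1 * M ^+ 2 + S)).
Proof.
move=> ST T0; rewrite noise_denominator_eq.
have L'0 := residual_curvature_gt0.
have -> : 40 * D * (K + 3) * T / (120 * D * L') = (K + 3) / 3 * (T / L').
  by field; rewrite !gt_eqF.
have TL : T / L' <= D * S / K ^+ 2.
  rewrite ler_pdivrMr // /L' mulrDr.
  have -> : D * S / K ^+ 2 * (K * S / (120 * D)) = T.
    have -> : T = S ^+ 2 / (120 * K) by rewrite ST; field; rewrite gt_eqF.
    by field; rewrite !gt_eqF.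
  rewrite lerDr; apply: mulr_ge0.
    by rewrite divr_ge0 ?sqr_ge0 // mulr_ge0 // ltW.
  by rewrite mulr_ge0 // mulr_ge0 ?sqr_ge0 // mulr_ge0 // ltW.
have h1 : (K - 1) / 3 * (T / L') <= (K - 1) / 3 * (D * S / K ^+ 2).
  by apply: ler_wpM2l TL; rewrite divr_ge0 // ltW.
have h2 : (K - 1) / 3 * (D * S / K ^+ 2) <= 117 * (D * S) / (60 * (K - 1)).
  have -> : (K - 1) / 3 * (D * S / K ^+ 2) = ((K - 1) * (D * S)) / (3 * K ^+ 2).
    by field; rewrite gt_eqF.
  rewrite ler_pdivrMr ?mulr_gt0 ?exprn_gt0 // mulrAC ler_pdivlMr ?mulr_gt0 //.
  have DS0 : 0 <= D * S by rewrite mulr_ge0 // ltW.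
  rewrite (_ : (K - 1) * (D * S) * (60 * (K - 1)) = (D * S) * (60 * (K - 1) ^+ 2)); last by ring.
  rewrite (_ : 117 * (D * S) * (3 * K ^+ 2) = (D * S) * (351 * K ^+ 2)); last by ring.
  apply: ler_wpM2l => //.
  by have := sqr_ge0 K; have := K2; lra.
have -> : 13 * D * S / (6 * (K - 1)) = 13 * D * S / (60 * (K - 1)) + 117 * (D * S) / (60 * (K - 1)).
  by field; rewrite gt_eqF.
lra.
Qed.
End FinalConstants.

(** * The convergence bounds *)

Theorem theorem2 (R : realType) (n m : nat)
    (d d' : measure_display)
    (Omega : measurableType d) (Xi : measurableType d')
    (P : probability Omega R)
    (X : set 'cV[R]_n)
    (f : 'cV[R]_n -> R) (chi0 : 'cV[R]_n -> \bar R)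
    (g chi : 'cV[R]_n -> 'cV[R]_m)
    (f' : 'cV[R]_n -> 'cV[R]_n) (g' : 'cV[R]_n -> 'M[R]_(n, m))
    (Lf Hf sigma : R) (Lg Hg Mg Mchi : 'cV[R]_m)
    (F : 'cV[R]_n -> Xi -> 'cV[R]_n) (xi : nat -> {RV P >-> Xi})
    (xs : 'cV[R]_n) (ys : 'cV[R]_m)
    (K : nat) (B : R) (x1 : 'cV[R]_n) (y1 : 'cV[R]_m)
    (tau rho eta beta L : nat -> R)
    (Z : nat -> Omega -> state R n m) :
  let D := half_diam X in
  let M := enorm Mg + enorm Mchi in
  let Hstar := enorm Lg * D * Num.max (enorm ys + 1 - B) 0
               + enorm Hg * (enorm ys + 1) in
  let S : R := Num.sqrt (120 * K%:R * (Hstar ^+ 2 + 2 * (Hf ^+ 2 + sigma ^+ 2))) in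
  let Lsum := Lf + B * enorm Lg + rho 1%N * K%:R * M ^+ 2 in
  let xK := fun w => st_x (Z K w) in
  let violation := fun w => pos_part (psi g chi (xK w)) in
  (* if the violation is 0, this is 0 *)
  let yhat : Omega -> 'cV[R]_m := fun w =>
    (enorm ys + 1) *: ((enorm (violation w))^-1 *: violation w) in
  (* the problem *)
  convex_set X -> compact X -> 0 < D ->
  convex_function X f ->
  (forall i, convex_function X (fun x => g x i 0)) ->
  econvex_on X chi0 -> proper_on X chi0 ->
  lower_semicontinuous (chi0 : subspace X -> \bar R) ->
  (forall i, convex_function X (fun x => chi x i 0)) ->
  (forall i, {within X, continuous (fun x => chi x i 0)}) ->
  (* the constants *)
  0 <= Lf -> 0 <= Hf -> 0 <= sigma ->
  (forall i, [/\ 0 <= Lg i 0, 0 <= Hg i 0, 0 <= Mg i 0 & 0 <= Mchi i 0]) ->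
  0 < M ->
  upper_model X f Lf Hf ->
  (forall i, upper_model X (fun x => g x i 0) (Lg i 0) (Hg i 0)) ->
  (forall i, lipschitz_bound X (fun x => g x i 0) (Mg i 0)) ->
  (forall i, lipschitz_bound X (fun x => chi x i 0) (Mchi i 0)) ->
  (* first-order information and stochastic oracle *)
  (forall x, X x -> subdiff X f x (f' x)) ->
  (forall x i, X x -> subdiff X (fun z => g z i 0) x (col i (g' x))) ->
  measurable_oracle X F ->
  (forall k, (0 < k < K)%N ->
     unbiased_bounded_variance P X F f' sigma (xi k)) ->
  mutually_independent P [set k | (0 < k < K)%N] xi ->
  (forall k, (0 < k < K)%N -> independent_of P (history Z xi k) (xi k)) ->
  (* the saddle point *)
  saddle_point X f chi0 g chi xs ys ->
  (* the parameters *)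
  (2 <= K)%N -> 1 <= B -> 0 < rho 1%N ->
  (forall k, (0 < k <= K)%N -> tau k = 2 / (k%:R + 1)) ->
  (forall k, (0 < k < K)%N -> rho k.+1 = rho 1%N * (k%:R + 2)) ->
  (forall k, (0 < k < K)%N -> eta k = rho 1%N * (k%:R ^+ 2 / K%:R)) ->
  (forall k, (0 < k < K)%N ->
     beta k.+1 = (1 - tau k) * tau k.+1 / tau k) ->
  (forall k, (0 < k < K)%N ->
     L k = 2 * Lsum + K%:R * S / (120 * D)) ->
  (* the run *)
  X x1 ->
  (forall w, Z 1%N w = init_state g chi x1 y1) ->
  (forall k w, (0 < k < K)%N ->
     aug_conex_step X chi0 g chi g' (rho k) (eta k) (L k) (tau k) (beta k.+1)
       (F (st_xhat (Z k w)) (xi k w)) (Z k w) (Z k.+1 w)) ->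
  (forall k w, (0 < k < K)%N -> X (st_xhat (Z k w))) ->
  (forall k, (0 < k <= K)%N -> random_state (Z k)) ->
  ((\int[P]_w (psi0 f chi0 (xK w) - psi0 f chi0 xs) <=
     (13 * D * S / (60 * (K%:R - 1))
      + enorm y1 ^+ 2 / ((K%:R - 1) * rho 1%N)
      + 52 * D ^+ 2 * Lsum / ((K%:R - 1) * K%:R)
      + 80 * D * (K%:R + 3) * (Hf ^+ 2 + sigma ^+ 2)
        / (K%:R * (240 * D * rho 1%N * M ^+ 2 + S))
      + 2 * (Hf ^+ 2 + sigma ^+ 2)
        / (K%:R ^+ 2 * (K%:R - 1) * rho 1%N * M ^+ 2))%:E)%E)
  /\
  (('E_P[(fun w => enorm (violation w))] <=
     (13 * D * S / (6 * (K%:R - 1))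
      + 52 * D ^+ 2 * Lsum / ((K%:R - 1) * K%:R)
      + 40 * D * (K%:R + 3) * (Hstar ^+ 2 + 2 * (Hf ^+ 2 + sigma ^+ 2))
        / (K%:R * (240 * D * rho 1%N * M ^+ 2 + S)))%:E
     + 'E_P[(fun w => enorm (y1 - yhat w) ^+ 2)%R]
       * (((K%:R - 1) * rho 1%N)^-1)%:E
     + ((Hstar ^+ 2 + 2 * (Hf ^+ 2 + sigma ^+ 2))
        / (K%:R ^+ 2 * (K%:R - 1) * rho 1%N * M ^+ 2))%:E)%E).
Proof.
move=> D M Hstar S Lsum xK violation yhat cX kX D0 cf cg cchi0 pr lsc cchi _.
move=> Lf0 Hf0 sigma0 consts M0 umf umg _ _ sdf sdg mF ubv _ indep sp K2 B1 rho10.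
move=> tauE rhoE etaE betaE LE Xx1 Z1 steps Xxh rndZ.
have Lg0 i : 0 <= Lg i 0 by case: (consts i).
have Hg0 i : 0 <= Hg i 0 by case: (consts i).
have Xs : X xs by case: sp.
have fins := saddle_fin sp.
have psis := saddle_feasible sp.
have KR2 : (2 : R) <= K%:R by rewrite ler_nat.
have KR0 : (0 : R) < K%:R by lra.
have KR1 : (0 : R) < K%:R - 1 by lra.
have S0 : 0 <= S by exact: sqrtr_ge0.
have Hstar0 : 0 <= Hstar.
  apply: addr_ge0; last by rewrite mulr_ge0 ?addr_ge0 ?enorm_ge0.
  apply: mulr_ge0; last by rewrite le_max lexx orbT.
  by rewrite mulr_ge0 ?enorm_ge0 // ltW.
pose E0 : R := Hf ^+ 2 + sigma ^+ 2.
have E00 : 0 <= E0 by rewrite addr_ge0 ?sqr_ge0.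
pose T0 : R := Hstar ^+ 2 + 2 * E0.
have T00 : 0 <= T0 by rewrite addr_ge0 ?sqr_ge0 // mulr_ge0.
have ST : S ^+ 2 = 120 * K%:R * T0 by rewrite sqr_sqrtr // !mulr_ge0.
pose Lk : R := 2 * Lsum + K%:R * S / (120 * D).
pose L' : R := 2 * (rho 1%N * K%:R * M ^+ 2) + K%:R * S / (120 * D).
have L'E : Lk - 2 * Lf - 2 * B * enorm Lg = L' by rewrite /Lk /L' /Lsum; ring.
have L'0 : 0 < L' := residual_curvature_gt0 D0 rho10 M0 S0 KR2.
have Lk0 : 0 <= Lk.
  have : 0 <= B * enorm Lg by rewrite mulr_ge0 ?enorm_ge0 //; lra.
  by move: L'E; lra.
pose G w k := F (st_xhat (Z k w)) (xi k w).
have steps' w k : (0 < k < K)%N ->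
    aug_conex_step X chi0 g chi g' (rho k) (eta k) Lk (tau k) (beta k.+1)
      (G w k) (Z k w) (Z k.+1 w).
  by move=> kK; rewrite -[Lk](LE k kK); exact: steps.
have Xx1' w : X (st_x (Z 1%N w)) by rewrite Z1.
have V1 w : st_V (Z 1%N w) = psi g chi (st_x (Z 1%N w)) by rewrite Z1.
have xh1 w : st_xhat (Z 1%N w) = st_x (Z 1%N w) by rewrite Z1.
have inv w k := run_invariants (st := fun k => Z k w) pr (Xx1' w) (V1 w) (steps' w) (k := k).
pose phi u := f u + fine (chi0 u).
pose target k w := (1 - tau k) *: st_x (Z k w) + tau k *: xs.
pose delta k w := G w k - f' (st_xhat (Z k w)).
pose W1 k w := dot (delta k w) (target k w - st_xhat (Z k w)).
pose W2 k w := enorm (delta k w) ^+ 2.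
have L'0' : 0 < Lk - 2 * Lf - 2 * B * enorm Lg by rewrite L'E.
have bound w y h := run_bound (st := fun k => Z k w) (G := G w) cX kX cf cg cchi0 pr cchi
  Lg0 Hg0 umf umg sdf sdg Xs fins psis K2 rho10 (erefl _) tauE rhoE etaE betaE (Xx1' w)
  (xh1 w) (V1 w) (steps' w) (fun k => Xxh k w) L'0' (y := y) (h := h) Lk0.
have KK : (0 < K <= K)%N by rewrite leqnn andbT ltnW.
have Xk k w : (0 < k <= K)%N -> X (st_x (Z k w)) by move=> /(inv w) [].
have xKfin w : chi0 (xK w) \is a fin_num by have [_ + _] := inv w K KK; exact.
have VK w i : psi g chi (xK w) i 0 <= st_V (Z K w) i 0 by have [_ _] := inv w K KK.
have indep' k : (0 < k < K)%N -> forall (A : set (borel_cV R n * borel_cV R n)) C,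
    measurable A -> measurable C ->
    (P ((fun w => (st_x (Z k w), st_xhat (Z k w))) @^-1` A `&` xi k @^-1` C) =
     P ((fun w => (st_x (Z k w), st_xhat (Z k w))) @^-1` A) * P (xi k @^-1` C))%E.
  move=> kK A C mA mC; apply: indep => //; have /andP[k0 _] := kK.
  exact: history_state_pair.
have hW1 k : (0 < k < K)%N ->
    P.-integrable setT (EFin \o W1 k) /\ (\int[P]_w (W1 k w)%:E = 0)%E.
  move=> kK; have kK' : (0 < k <= K)%N by case/andP: kK => -> /ltnW.
  have [mx [mxh _]] := rndZ k kK'.
  by have [] := oracle_noise_mean0 kX mF (ubv k kK) (fun w => Xk k w kK')
    (fun w => Xxh k w kK) mx mxh (indep' k kK) (tau k) xs.
have hW2 k : (0 < k < K)%N -> measurable_fun setT (W2 k) /\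
    (\int[P]_w (W2 k w)%:E <= (sigma ^+ 2)%:E)%E.
  move=> kK; have kK' : (0 < k <= K)%N by case/andP: kK => -> /ltnW.
  have [mx [mxh _]] := rndZ k kK'.
  exact: (oracle_noise_variance kX mF (ubv k kK) (fun w => Xxh k w kK) mx mxh (indep' k kK)).
have W20 k w : 0 <= W2 k w by exact: sqr_ge0.
pose kk : R := (K%:R - 1) * K%:R.
have kk0 : 0 < kk by exact: mulr_gt0.
have lead : 26 * D ^+ 2 * Lk / kk =
    52 * D ^+ 2 * Lsum / kk + 13 * D * S / (60 * (K%:R - 1)).
  exact: (@leading_term_eq _ _ (Lf + B * enorm Lg) (rho 1%N) M S _ D0 KR2).
pose wt k : R := k%:R * (k%:R + 1) / kk.
have wt0 k : 0 <= wt k.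
  by apply: divr_ge0; [rewrite mulr_ge0 // addr_ge0|exact: ltW].
have wtsum : \sum_(1 <= k < K) wt k = (K%:R + 1) / 3.
  rewrite -mulr_suml sum_weights ?(ltnW K2) // /kk; field.
  by rewrite !gt_eqF.
(* Stated at each sample point for every [y], so that [y] may be chosen as [yhat w]; [W1] and [W2]
   do not involve it. *)
have noise (A q h : R) (y : 'cV[R]_m) w : (forall t, (h + t) ^+ 2 <= A + q * t ^+ 2) ->
    (forall i, 0 <= y i 0) ->
    Hf + enorm y * enorm Hg + enorm Lg * D * Num.max (enorm y - B) 0 <= h ->
    phi (xK w) - phi xs + dot y (st_V (Z K w)) <=
      26 * D ^+ 2 * Lk / kk + enorm (y1 - y) ^+ 2 / ((K%:R - 1) * rho 1%N)
      + \sum_(1 <= k < K) wt k * ((A + q * W2 k w) / L' + W1 k w).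
  move=> hA y0 hy; have := bound w y h y0 hy.
  rewrite L'E Z1 /= -/kk -/(xK w) => H.
  rewrite -(ler_pM2l kk0); apply: (le_trans H).
  rewrite !mulrDr; apply: lerD.
    by rewrite le_eqVlt; apply/orP; left; apply/eqP; rewrite /kk; field; rewrite !gt_eqF.
  rewrite mulr_sumr; apply: ler_sum => k _.
  rewrite /wt mulrA (mulrC kk) divfK ?gt_eqF //.
  apply: ler_wpM2l; first by rewrite mulr_ge0 // addr_ge0.
  by rewrite lerD2r ler_pM2r ?invr_gt0 //; exact: hA.
split.
- have hA t : (Hf + t) ^+ 2 <= 2 * Hf ^+ 2 + 2 * t ^+ 2.
    by have := sqr_ge0 (Hf - t); nra.
  have h0 : Hf + enorm (0 : 'cV[R]_m) * enorm Hg
      + enorm Lg * D * Num.max (enorm (0 : 'cV[R]_m) - B) 0 <= Hf.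
    rewrite enorm0 mul0r sub0r addr0 (max_idPr _) ?mulr0 ?addr0 //; lra.
  pose C := 26 * D ^+ 2 * Lk / kk + enorm y1 ^+ 2 / ((K%:R - 1) * rho 1%N).
  have [iN lN] := expected_noise_sum_le C (2 * Hf ^+ 2) hW1 hW2 W20 wt0 (ler0n R 2) L'0.
  apply: (@le_trans _ _ (\int[P]_w (C + \sum_(1 <= k < K) wt k *
      ((2 * Hf ^+ 2 + 2 * W2 k w) / L' + W1 k w))%:E)%E).
    apply: le_integral_nonmeasurable iN _ => w /=.
    rewrite !psi0_fin // -EFinB lee_fin.
    have := noise _ _ _ 0 w hA (fun i => _) h0; rewrite dot0l addr0 subr0.
    by apply=> i; rewrite mxE.
  apply: (le_trans lN); rewrite lee_fin wtsum -mulrDr /C.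
  rewrite lead.
  have := objective_noise_le D0 rho10 M0 S0 KR2 E00.
  have : 0 <= 2 * E0 / (K%:R ^+ 2 * (K%:R - 1) * rho 1%N * M ^+ 2).
    by rewrite divr_ge0 ?mulr_ge0 ?sqr_ge0 // ltW.
  rewrite -/L' -/E0 -/kk => hT hN; apply: le_trans (lerD (lexx _) hN) _.
  rewrite -subr_ge0; apply: (le_trans hT).
  by rewrite le_eqVlt; apply/orP; left; apply/eqP; ring.
- rewrite !expectationE.
  pose h := Hf + Hstar.
  (* Squaring in two stages, first splitting off [Hstar], gives these weights; in expectation they
     add up to [2 * T0]. *)
  have hA t : (h + t) ^+ 2 <= (2 * Hstar ^+ 2 + 4 * Hf ^+ 2) + 4 * t ^+ 2.
    have := sqr_ge0 (Hf - t); have := sqr_ge0 (Hstar - (Hf + t)); rewrite /h; nra.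
  pose C := 26 * D ^+ 2 * Lk / kk.
  have [iN lN] := expected_noise_sum_le C (2 * Hstar ^+ 2 + 4 * Hf ^+ 2) hW1 hW2 W20 wt0 (ler0n R 4) L'0.
  pose c : R := ((K%:R - 1) * rho 1%N)^-1.
  have c0 : 0 < c by rewrite invr_gt0 mulr_gt0.
  have mv : measurable_fun setT (fun w => enorm (violation w)).
    apply: measurable_enorm_pos_part => i.
    have [_ [_ [ms [_ [_ mV]]]]] := rndZ K KK.
    (* Measurability of the constraint values is read off from the random vectors V_K and s_K, whose
       sum they are. *)
    have -> : (fun w => psi g chi (xK w) i 0) =
        (fun w => st_V (Z K w) i 0 + st_s (Z K w) i 0).
      apply/funext => w.
      have KK' : (0 < K.-1 < K)%N by rewrite ltn_predL (ltnW K2) andbT -subn1 subn_gt0.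
      have [_ [_ [_ [+ _]]]] := steps' w K.-1 KK'.
      rewrite prednK ?(ltnW K2) // => ->.
      by rewrite /psi /xK !mxE subrK.
    apply: measurable_funD.
      exact: (measurableT_comp (measurable_coord i) mV).
    exact: (measurableT_comp (measurable_coord i) ms).
  have key w : enorm (violation w) <=
      C + \sum_(1 <= k < K) wt k * ((2 * Hstar ^+ 2 + 4 * Hf ^+ 2 + 4 * W2 k w) / L' + W1 k w)
      + c * enorm (y1 - yhat w) ^+ 2.
    have [yh0 yhn gap] := violation_le_gap sp (Xk K w KK) (xKfin w) (VK w).
    have hy : Hf + enorm (yhat w) * enorm Hg
        + enorm Lg * D * Num.max (enorm (yhat w) - B) 0 <= h.
      rewrite /h /Hstar -addrA lerD2l addrC; apply: lerD.
        apply: ler_wpM2l; first by rewrite mulr_ge0 ?enorm_ge0 // ltW.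
        by rewrite ge_max !le_max lerD2r yhn lexx orbT.
      by rewrite mulrC ler_wpM2l ?enorm_ge0.
    apply: (le_trans gap); apply: (le_trans (noise _ _ _ _ w hA yh0 hy)).
    by rewrite addrAC -/C (mulrC c).
  have vn w : 0 <= enorm (violation w) by exact: enorm_ge0.
  have bn w : 0 <= enorm (y1 - yhat w) ^+ 2 by exact: sqr_ge0.
  apply: (le_trans (integral_le_add_nonmeasurable c0 mv iN vn bn key)).
  rewrite -/c [leRHS]addeAC; apply: leeD2r; apply: (le_trans lN).
  rewrite -EFinD lee_fin wtsum /C lead.
  have := feasibility_noise_le D0 rho10 M0 S0 KR2 ST T00.
  have : 0 <= T0 / (K%:R ^+ 2 * (K%:R - 1) * rho 1%N * M ^+ 2).
    by rewrite divr_ge0 ?mulr_ge0 ?sqr_ge0 // ltW.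
  have -> : 2 * Hstar ^+ 2 + 4 * Hf ^+ 2 + 4 * sigma ^+ 2 = 2 * T0.
    by rewrite /T0 /E0; ring.
  rewrite -/L' -/E0 -/T0 -/kk -addrA => hT hN; apply: le_trans (lerD (lexx _) hN) _.
  rewrite -subr_ge0; apply: (le_trans hT).
  by rewrite le_eqVlt; apply/orP; left; apply/eqP; ring.
Qed.
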